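(* Let $\mathcal A,\mathcal B\neq\mathbb C I$ be (von Neumann algebra) factors and let $\phi:E(\mathcal A)\to E(\mathcal B)$ be a sequential isomorphism. Then $\phi$ extends either to a *-isomorphism or to a *-antiisomorphism between the algebras $\mathcal A$ and $\mathcal B$.
   Context: A factor is a von Neumann algebra whose center consists of the scalar multiples of the identity $I$. For a unital $C^*$-algebra $\mathcal A$, $E(\mathcal A)$ denotes the set of effects of $\mathcal A$, i.e. all $A\in\mathcal A$ with $0\le A\le I$. The sequential product on $E(\mathcal A)$ is $A\circ B=A^{1/2}BA^{1/2}$. A sequential isomorphism is a bijective map $\phi:E(\mathcal A)\to E(\mathcal B)$ with $\phi(A\circ B)=\phi(A)\circ\phi(B)$ for all $A,B\in E(\mathcal A)$. A *-isomorphism (resp. *-antiisomorphism) is a bijective linear map $\psi:\mathcal A\to\mathcal B$ with $\psi(A^* )=\psi(A)^*$ and $\psi(AB)=\psi(A)\psi(B)$ (resp. $\psi(AB)=\psi(B)\psi(A)$) for all $A,B\in\mathcal A$. *)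

(* Defs.v *)
From HB Require Import structures.
From mathcomp Require Import all_boot all_order all_algebra.
From mathcomp Require Import complex.
From mathcomp Require Import all_classical all_reals all_analysis.

Set Implicit Arguments.
Unset Strict Implicit.
Unset Printing Implicit Defensive.

Import Order.TTheory GRing.Theory Num.Theory.
Import numFieldNormedType.Exports.

Local Open Scope classical_set_scope.
Local Open Scope ring_scope.
Local Open Scope complex_scope.

(* Complex Hilbert spaces, of arbitrary dimension. A {dot H for Num.conj} is a
   positive definite form, linear in its first argument and conjugate-linear
   in the second. *)
HB.mixin Record isHilbert (R : realType) H
    & CompleteNormedModule R[i] H := {
  inner : {dot H for (@Num.conj R[i])} ;
  normr_inner : forall x : H, `|x| ^+ 2 = inner x x }.

#[short(type="hilbertType")]
HB.structure Definition Hilbert (R : realType) :=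
  { H of CompleteNormedModule R[i] H & isHilbert R H }.

Section Operators.
Context (R : realType) (H : hilbertType R).
Implicit Types (S T : H -> H) (A : set (H -> H)).

(* B(H). Operators are plain functions: sum and scaling are the pointwise ones
   of the function space, the product is \o, the unit is idfun. *)
Definition bounded_ops : set (H -> H) := [set T | linear T /\ continuous T].

(* The default value 0 of xget is never used for T in B(H). *)
Definition adjoint T : H -> H :=
  xget 0 [set S | bounded_ops S /\ forall x y, inner (T x) y = inner x (S y)].

(* In R[i], 0 <= z means that z is real and nonnegative; as H is complex, a
   positive T in B(H) is therefore selfadjoint. *)
Definition positive_op T := forall x : H, 0 <= inner (T x) x.

Definition le_op S T := positive_op (T - S).

(* The unique positive square root in B(H) of a positive operator; it belongs
   to every C*-algebra of operators containing T. *)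
Definition sqrt_op T : H -> H :=
  xget 0 [set S | [/\ bounded_ops S, positive_op S & S \o S = T]].

Definition scalar_ops : set (H -> H) := [set c *: (idfun : H -> H) | c in setT].

Definition commutant A : set (H -> H) :=
  [set T | bounded_ops T /\ forall S, A S -> S \o T = T \o S].

Record von_neumann_algebra A : Prop := VonNeumannAlgebra {
  vN_bounded : A `<=` bounded_ops ;
  vN_unit : A idfun ;
  vN_linear : forall (c : R[i]) S T, A S -> A T -> A (c *: S + T) ;
  vN_mul : forall S T, A S -> A T -> A (S \o T) ;
  vN_adjoint : forall T, A T -> A (adjoint T) ;
  vN_bicommutant : commutant (commutant A) = A }.

Definition op_center A : set (H -> H) := A `&` commutant A.

Definition vn_factor A := von_neumann_algebra A /\ op_center A = scalar_ops.

Definition effects A : set (H -> H) :=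
  [set T | [/\ A T, le_op 0 T & le_op T idfun]].

Definition seq_prod S T : H -> H := sqrt_op S \o T \o sqrt_op S.

End Operators.

Arguments bounded_ops {R} H.
Arguments scalar_ops {R} H.

(* In the following definitions only the values of phi on effects A, and those
   of psi on A, are meaningful. *)
Section Maps.
Context (R : realType) (H K : hilbertType R).
Implicit Types (A : set (H -> H)) (B : set (K -> K)).
Implicit Types phi psi : (H -> H) -> (K -> K).

Definition sequential_isomorphism A B phi :=
  set_bij (effects A) (effects B) phi /\
  forall S T, effects A S -> effects A T ->
    phi (seq_prod S T) = seq_prod (phi S) (phi T).

Definition star_linear_bijection A B psi :=
  [/\ set_bij A B psi,
      forall (c : R[i]) S T, A S -> A T ->
        psi (c *: S + T) = c *: psi S + psi T
    & forall T, A T -> psi (adjoint T) = adjoint (psi T)].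

Definition star_isomorphism A B psi :=
  star_linear_bijection A B psi /\
  forall S T, A S -> A T -> psi (S \o T) = psi S \o psi T.

Definition star_antiisomorphism A B psi :=
  star_linear_bijection A B psi /\
  forall S T, A S -> A T -> psi (S \o T) = psi T \o psi S.

End Maps.

(* Main.v *)
Require Import Defs.
From HB Require Import structures.
From mathcomp Require Import all_boot all_order all_algebra.
From mathcomp Require Import complex.
From mathcomp Require Import all_classical all_reals all_analysis.
From mathcomp Require Import ring lra.

Set Implicit Arguments.
Unset Strict Implicit.
Unset Printing Implicit Defensive.

Import Order.TTheory GRing.Theory Num.Theory.
Import numFieldNormedType.Exports.

Local Open Scope classical_set_scope.
Local Open Scope ring_scope.
Local Open Scope complex_scope.

(** Let f be a sequential isomorphism between the effects of two factors other
    than the scalars.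

    Since f is multiplicative on commuting effects and respects commutation
    ([seq_commute], [si_comm]), it maps scalars to scalars, by an increasing
    multiplicative bijection of [0, 1] that could still be a power t^c.
    Noncommutativity excludes c <> 1: a factor other than the scalars contains
    projections P <> 0 and Q with P Q P = P / 2 ([half_projections]), and from
    f (1 - Q) = 1 - f Q one gets f (1/2) = 1/2 ([si_half]). So f is homogeneous
    ([si_scale]).

    The heart of the proof is f T + f (1 - T) = 1. Expand
    1 = (T + (1 - T))^n by the binomial formula. Each of the n + 1 terms is an
    effect, and f maps it to the corresponding term of (f T + f (1 - T))^n.
    Hence this power is at most n + 1 for every n, which leaves only
    f T + f (1 - T) <= 1 ([si_compl_le]). The same inequality for the inverse of
    f, together with monotonicity, gives equality ([si_compl]).

    Additivity is now immediate: effects S and T with S + T invertible are the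
    sequential products of S + T with complementary effects C and 1 - C, so
    f S + f T = f (S + T) by multiplicativity; a shift by scalars removes the
    invertibility ([si_add]).

    An additive, homogeneous f extends to a linear bijection of the algebras
    which preserves adjoints and squares ([ext], [ext_sq]). Factors are prime
    ([factor_prime]), and a Jordan homomorphism onto a prime algebra is
    multiplicative or antimultiplicative ([jordan_alternative]).

    Only elementary Hilbert space theory enters. Square roots come from an
    iteration, and the spectral projections that are needed are projections
    onto kernels. Commutation is obtained without holomorphic functions: if the
    product of two positive operators is normal, it is selfadjoint
    ([pos_mul_normal]). *)

(** * The real inner product of a Hilbert space *)

Section Hilbert.
Context (R : realType) (H : hilbertType R).
Implicit Types x y z : H.

(** The real part of the inner product makes H a real inner product space, so
    that inequalities live in the totally ordered R and not in R[i]. *)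
Definition rip x y : R := complex.Re (inner x y).
Definition hnorm x : R := Num.sqrt (rip x x).

Lemma innerDl x y z : inner (x + y) z = inner x z + inner y z.
Proof. exact: linearDl. Qed.
Lemma innerDr x y z : inner x (y + z) = inner x y + inner x z.
Proof. exact: linearDr. Qed.
Lemma innerZl c x y : inner (c *: x) y = c * inner x y.
Proof. exact: linearZl_LR. Qed.
Lemma innerZr c x y : inner x (c *: y) = conjc c * inner x y.
Proof. exact: linearZr_LR. Qed.
Lemma innerNl x y : inner (- x) y = - inner x y.
Proof. exact: linearNl. Qed.
Lemma innerNr x y : inner x (- y) = - inner x y.
Proof. exact: linearNr. Qed.
Lemma inner0l x : inner 0 x = 0.
Proof. exact: linear0l. Qed.
Lemma inner0r x : inner x 0 = 0.
Proof. exact: linear0r. Qed.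
Lemma innerC x y : inner y x = conjc (inner x y).
Proof. by rewrite (hermC (@inner R H) y x) expr0 mul1r. Qed.
Lemma inner_ge0 x : 0 <= inner x x.
Proof. exact: (dnorm_ge0 (@inner R H)). Qed.
Lemma inner_self_eq0 x : inner x x = 0 -> x = 0.
Proof. by move/eqP; rewrite (dnorm_eq0 (@inner R H)) => /eqP. Qed.

Lemma RecD (a b : R[i]) : complex.Re (a + b) = complex.Re a + complex.Re b.
Proof. by case: a; case: b. Qed.
Lemma RecN (a : R[i]) : complex.Re (- a) = - complex.Re a.
Proof. by case: a. Qed.
Lemma RecZ (r : R) (a : R[i]) : complex.Re (r%:C * a) = r * complex.Re a.
Proof. by case: a => a b /=; rewrite mul0r subr0. Qed.

Lemma ripDl x y z : rip (x + y) z = rip x z + rip y z.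
Proof. by rewrite /rip innerDl RecD. Qed.
Lemma ripDr x y z : rip x (y + z) = rip x y + rip x z.
Proof. by rewrite /rip innerDr RecD. Qed.
Lemma ripNl x y : rip (- x) y = - rip x y.
Proof. by rewrite /rip innerNl RecN. Qed.
Lemma ripNr x y : rip x (- y) = - rip x y.
Proof. by rewrite /rip innerNr RecN. Qed.
Lemma ripZl (r : R) x y : rip (r%:C *: x) y = r * rip x y.
Proof. by rewrite /rip innerZl RecZ. Qed.
Lemma ripZr (r : R) x y : rip x (r%:C *: y) = r * rip x y.
Proof. by rewrite /rip innerZr conjc_real RecZ. Qed.
Lemma ripC x y : rip y x = rip x y.
Proof. by rewrite /rip innerC; case: (inner x y). Qed.
Lemma rip0l x : rip 0 x = 0. Proof. by rewrite /rip inner0l. Qed.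
Lemma rip0r x : rip x 0 = 0. Proof. by rewrite /rip inner0r. Qed.
Lemma inner_rip x : inner x x = (rip x x)%:C.
Proof.
by rewrite /rip; have := inner_ge0 x; rewrite lecE; case: (inner x x) => a b /= /andP[/eqP ->].
Qed.
Lemma rip_ge0 x : 0 <= rip x x.
Proof. by have := inner_ge0 x; rewrite inner_rip ler0c. Qed.
Lemma rip_eq0 x : rip x x = 0 -> x = 0.
Proof. by move=> e; apply: inner_self_eq0; rewrite inner_rip e. Qed.

Definition ripE := (ripDl, ripDr, ripNl, ripNr, ripZl, ripZr, rip0l, rip0r).

(** Estimates take place in the ordered field R; this formula is the way back
    to complex identities. *)
Lemma inner_riP x y : inner x y = Complex (rip x y) (rip x ('i *: y)).
Proof. by rewrite /rip innerZr; case: (inner x y) => a b /=; congr Complex; ring. Qed.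

Lemma hnorm_ge0 x : 0 <= hnorm x. Proof. exact: sqrtr_ge0. Qed.
Lemma hnorm2 x : hnorm x ^+ 2 = rip x x.
Proof. by rewrite sqr_sqrtr ?rip_ge0. Qed.
Lemma normr_hnorm x : `|x| = (hnorm x)%:C.
Proof.
apply/eqP; rewrite -(eqrXn2 (_ : 0 < 2)%N) //; last by rewrite ler0c hnorm_ge0.
by rewrite normr_inner -rmorphXn /= hnorm2 inner_rip.
Qed.

(** Source of every Cauchy-Schwarz inequality below, for the inner product and
    for the forms of positive operators. *)
Lemma discriminant_le (a b c : R) : 0 <= c ->
  (forall t, 0 <= a + 2 * t * b + t ^+ 2 * c) -> b ^+ 2 <= a * c.
Proof.
move=> c0 h; have [c1|c1] := eqVneq c 0.
  rewrite {c0}c1 mulr0 in h *.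
  have [->|b0] := eqVneq b 0; first by rewrite expr0n.
  have := h (- (a + 1) / (2 * b)).
  have -> : a + 2 * (- (a + 1) / (2 * b)) * b + (- (a + 1) / (2 * b)) ^+ 2 * 0 = -1.
    by field.
  lra.
have := h (- b / c).
have -> : a + 2 * (- b / c) * b + (- b / c) ^+ 2 * c = (a * c - b ^+ 2) / c by field.
have cp : 0 < c by rewrite lt_def c1.
by rewrite pmulr_lge0 ?invr_gt0 // subr_ge0.
Qed.

Lemma rip_CS x y : rip x y ^+ 2 <= rip x x * rip y y.
Proof.
apply: discriminant_le => [|t]; first exact: rip_ge0.
have := rip_ge0 (x + t%:C *: y).
by rewrite !ripE (ripC x y); lra.
Qed.

Lemma rip_le x y : rip x y <= hnorm x * hnorm y.
Proof.
apply: le_trans (ler_norm _) _.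
rewrite -(@ler_pXn2r _ 2) ?nnegrE ?mulr_ge0 ?hnorm_ge0 //.
by rewrite real_normK ?num_real // exprMn !hnorm2 rip_CS.
Qed.

Lemma hnormD x y : hnorm (x + y) <= hnorm x + hnorm y.
Proof.
rewrite -(@ler_pXn2r _ 2) ?nnegrE ?addr_ge0 ?hnorm_ge0 //.
by rewrite sqrrD !hnorm2 !ripE (ripC x y); have := rip_le x y; lra.
Qed.
Lemma hnormZ (r : R) x : hnorm (r%:C *: x) = `|r| * hnorm x.
Proof.
by rewrite /hnorm !ripE mulrA -expr2 sqrtrM ?sqr_ge0 // sqrtr_sqr.
Qed.
Lemma hnormN x : hnorm (- x) = hnorm x.
Proof. by rewrite /hnorm !ripE opprK. Qed.
Lemma hnormB x y : hnorm (x - y) = hnorm (y - x).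
Proof. by rewrite -hnormN opprB. Qed.
Lemma hnorm0 : hnorm 0 = 0. Proof. by rewrite /hnorm rip0l sqrtr0. Qed.
Lemma hnorm_eq0 x : hnorm x = 0 -> x = 0.
Proof. by move=> e; apply: rip_eq0; rewrite -hnorm2 e expr0n. Qed.
Lemma hnorm_small x : (forall e, 0 < e -> hnorm x <= e) -> x = 0.
Proof.
move=> h; apply: hnorm_eq0; apply/eqP; rewrite eq_le hnorm_ge0 andbT.
by apply/ler_addgt0Pl => e e0; rewrite addr0 h.
Qed.
Lemma hnorm_sqr_le x (c : R) : 0 <= c -> rip x x <= c ^+ 2 -> hnorm x <= c.
Proof. by move=> c0; rewrite -hnorm2 ler_pXn2r // nnegrE ?hnorm_ge0. Qed.
Lemma hnorm_le x y : (hnorm x <= hnorm y) = (rip x x <= rip y y).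
Proof. by rewrite /hnorm ler_sqrt // rip_ge0. Qed.

Lemma parallelogram x y :
  rip (x + y) (x + y) + rip (x - y) (x - y) = 2 * rip x x + 2 * rip y y.
Proof. by rewrite !ripE (ripC x y); ring. Qed.

Lemma hcomplete (u : nat -> H) :
  (forall e, 0 < e -> exists N, forall m n, (N <= m)%N -> (N <= n)%N ->
     hnorm (u m - u n) <= e) ->
  exists l, forall e, 0 < e -> exists N, forall n, (N <= n)%N -> hnorm (u n - l) <= e.
Proof.
move=> cu.
have : cauchy (u @ \oo).
  apply/cauchy_exP => e e0.
  have [eR e1] : exists r : R, e = r%:C.
    by exists (complex.Re e); rewrite RRe_real // gtr0_real.
  have r0 : 0 < eR by move: e0; rewrite e1 ltcR.
  have [N hN] := cu _ (divr_gt0 r0 (ltr0n _ 2)).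
  exists (u N); exists N => // n /= Nn.
  rewrite /= -ball_normE /= normr_hnorm e1 ltcR.
  by apply: le_lt_trans (hN _ _ (leqnn _) Nn) _; lra.
move/cauchy_cvgP/cvg_ex => [l ul]; exists l => e e0.
have eC : 0 < e%:C by rewrite ltcR.
have /cvgrPdist_le /(_ _ eC) [N _ hN] := ul.
by exists N => n Nn; have := hN n Nn; rewrite /= normr_hnorm lecR hnormB.
Qed.

End Hilbert.

(** * Orthogonal projection onto a closed subspace *)

Section Projection.
Context (R : realType) (H : hilbertType R).
Implicit Types (x y z : H) (M : set H).

Lemma invS_small (e : R) : 0 < e -> exists N, forall n, (N <= n)%N -> (n.+1%:R)^-1 <= e.
Proof.
move=> e0; have ei : 0 <= e^-1 by rewrite invr_ge0 ltW.
exists (Num.bound e^-1) => n Nn.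
rewrite -[leRHS]invrK lef_pV2 ?posrE ?invr_gt0 ?ltr0n //.
by apply: le_trans (ltW (archi_boundP ei)) _; rewrite ler_nat (leq_trans Nn).
Qed.

Definition subspace M := M 0 /\ forall c x y, M x -> M y -> M (c *: x + y).
Definition hclosed M :=
  forall x, (forall e, 0 < e -> exists2 m, M m & hnorm (x - m) <= e) -> M x.

Lemma inner_eq0 x y : rip x y = 0 -> rip x ('i *: y) = 0 -> inner x y = 0.
Proof. by move=> a b; rewrite inner_riP a b. Qed.

Lemma subspaceZ M c x : subspace M -> M x -> M (c *: x).
Proof. by case=> M0 Ml Mx; rewrite -[_ *: _]addr0; apply: Ml. Qed.
Lemma subspaceD M x y : subspace M -> M x -> M y -> M (x + y).
Proof. by case=> M0 Ml Mx My; rewrite -[x]scale1r; apply: Ml. Qed.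
Lemma subspaceN M x : subspace M -> M x -> M (- x).
Proof. by move=> sM Mx; rewrite -scaleN1r; apply: subspaceZ. Qed.

(** By the parallelogram law a minimizing sequence for the distance from x to
    M is Cauchy. Its limit m is a nearest point, and the distance cannot be
    decreased along any y in M only if x - m is orthogonal to y. *)
Lemma projection_exists M x : subspace M -> hclosed M ->
  exists2 m, M m & forall y, M y -> inner (x - m) y = 0.
Proof.
move=> sM cM; pose D := [set r | exists2 m, M m & r = hnorm (x - m)].
have lbD : lbound D 0 by move=> _ [m _ ->]; exact: hnorm_ge0.
have hiD : has_inf D by split; [exists (hnorm (x - 0)), 0 => //; case: sM | exists 0].
pose d := inf D.
have d_ge0 : 0 <= d by apply: lb_le_inf => //; case: hiD.
have dP m : M m -> d <= hnorm (x - m).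
  by move=> Mm; apply: ge_inf; [case: hiD | exists m].
have near n : exists m, M m /\ hnorm (x - m) <= d + (n.+1%:R)^-1.
  have n0 : 0 < (n.+1%:R)^-1 :> R by rewrite invr_gt0 ltr0n.
  have [_ [m Mm ->] lt] := inf_adherent n0 hiD.
  by exists m; split=> //; apply: ltW.
have [u uP] := choice near.
have [|m mP] := @hcomplete _ _ u.
  move=> e e0; have k0 : 0 < 8 * d + 4 by lra.
  (* two terms within del of the distance d are at square distance at most
     8 d del + 4 del^2, hence at most (8 d + 4) del as del <= 1 *)
  pose del := Num.min 1 (e ^+ 2 / (8 * d + 4)).
  have del0 : 0 < del by rewrite /del lt_min ltr01 divr_gt0 // exprn_gt0.
  have [N NP] := invS_small del0; exists N => p q Np Nq.
  apply: hnorm_sqr_le; first exact: ltW.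
  have := parallelogram (x - u p) (x - u q).
  have -> : x - u p - (x - u q) = - (u p - u q) by rewrite [RHS]opprB opprB addrC subrKA.
  have -> : x - u p + (x - u q) = 2%:C *: (x - (2^-1)%:C *: (u p + u q)).
    rewrite scalerBr scalerA -rmorphM mulfV ?pnatr_eq0 // scale1r.
    by rewrite (_ : 2%:C = 2%:R) ?rmorph_nat // scaler_nat mulr2n addrACA opprD.
  rewrite !ripNl !ripNr !opprK !ripZl !ripZr -!hnorm2.
  have Mpq : M ((2^-1)%:C *: (u p + u q)).
    by apply: subspaceZ => //; apply: subspaceD => //; [case: (uP p)|case: (uP q)].
  have h0 := dP _ Mpq.
  have [[_ h1] [_ h2]] := (uP p, uP q).
  have [g1 g2] := (NP _ Np, NP _ Nq).
  have dl1 : del <= 1 by rewrite /del ge_min lexx.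
  have dl2 : (8 * d + 4) * del <= e ^+ 2.
    by rewrite mulrC -ler_pdivlMr // /del ge_min lexx orbT.
  have h1' : hnorm (x - u p) <= d + del by rewrite (le_trans h1) // lerD2l.
  have h2' : hnorm (x - u q) <= d + del by rewrite (le_trans h2) // lerD2l.
  have [k1 k2] := (hnorm_ge0 (x - u p), hnorm_ge0 (x - u q)).
  set a := hnorm (x - u p) in h1' k1 *; set b := hnorm (x - u q) in h2' k2 *.
  set c := hnorm (x - _) in h0 *.
  move=> E.
  have a2 : a ^+ 2 <= (d + del) ^+ 2 by rewrite ler_pXn2r // nnegrE; lra.
  have b2 : b ^+ 2 <= (d + del) ^+ 2 by rewrite ler_pXn2r // nnegrE; lra.
  have c2 : d ^+ 2 <= c ^+ 2 by rewrite ler_pXn2r // nnegrE; lra.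
  have dd : del ^+ 2 <= del by rewrite expr2 ger_pMr.
  have -> : hnorm (u p - u q) ^+ 2 = 2 * a ^+ 2 + 2 * b ^+ 2 - 4 * c ^+ 2 by lra.
  have : (d + del) ^+ 2 = d ^+ 2 + 2 * d * del + del ^+ 2 by ring.
  lra.
have Mm : M m.
  apply: cM => e e0; have [N NP] := mP e e0; exists (u N); first by case: (uP N).
  by rewrite hnormB; apply: NP.
have md : hnorm (x - m) <= d.
  apply/ler_addgt0Pl => e e0; have e2 : 0 < e / 2 by lra.
  have [N NP] := mP _ e2; have [N' NP'] := invS_small e2.
  pose n := maxn N N'.
  have -> : x - m = (x - u n) + (u n - m) by rewrite addrA subrK.
  apply: le_trans (hnormD _ _) _.
  have := NP n (leq_maxl _ _); have := NP' n (leq_maxr _ _); have [_] := uP n.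
  move: (_^-1) => i; lra.
exists m => //.
have key y : M y -> rip (x - m) y = 0.
  move=> My; apply/eqP; rewrite -sqrf_eq0 eq_le sqr_ge0 andbT.
  rewrite -[leRHS](mul0r (rip y y)); apply: discriminant_le => [|t].
    exact: rip_ge0.
  have Mt : M (m - t%:C *: y).
    by apply: subspaceD => //; apply: subspaceN => //; apply: subspaceZ.
  have h1 : d ^+ 2 <= hnorm (x - (m - t%:C *: y)) ^+ 2.
    by rewrite ler_pXn2r ?nnegrE ?hnorm_ge0 //; apply: dP.
  have h2 : hnorm (x - m) ^+ 2 <= d ^+ 2.
    by rewrite ler_pXn2r ?nnegrE ?hnorm_ge0.
  move: h1 h2; rewrite opprB addrCA addrC !hnorm2.
  by rewrite [X in _ <= X -> _]ripDl !ripDr !ripZl !ripZr (ripC y); lra.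
by move=> y My; apply: inner_eq0; apply: key => //; apply: subspaceZ.
Qed.

End Projection.

(** * The ring of bounded operators and the adjoint *)

Section BoundedOps.
Context (R : realType) (H : hilbertType R).
Implicit Types (x y z : H) (f : H -> H).

Definition hbounded f := exists2 C, 0 <= C & forall x, hnorm (f x) <= C * hnorm x.

Lemma bounded_opsP f : bounded_ops H f <-> linear f /\ hbounded f.
Proof.
split=> -[lf h]; split=> //.
  pose g : {linear H -> H} := HB.pack f (GRing.isLinear.Build _ _ _ _ f lf).
  have /linear_boundedP/pinfty_ex_gt0[c c0 hc] := continuous_linear_bounded 0 (f := g) (h 0).
  have cE : c = (complex.Re c)%:C by rewrite RRe_real // gtr0_real.
  exists (complex.Re c); first by rewrite -ler0c -cE ltW.
  by move=> x; have := hc x; rewrite !normr_hnorm cE -rmorphM lecR.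
case: h => C C0 hC.
pose g : {linear H -> H} := HB.pack f (GRing.isLinear.Build _ _ _ _ f lf).
apply: (bounded_linear_continuous (f := g)); apply/linear_boundedP.
exists C%:C; split; first by rewrite ger0_real // ler0c.
move=> r Cr x; rewrite !normr_hnorm.
have rE : r = (complex.Re r)%:C.
  by rewrite RRe_real // gtr0_real // (le_lt_trans _ Cr) // ler0c.
rewrite rE -rmorphM lecR; apply: le_trans (hC x) _.
by rewrite ler_wpM2r ?hnorm_ge0 //; rewrite rE ltcR in Cr; exact: ltW.
Qed.

(** Bundling the bounded operators gives them a ring structure. It is the zero
    ring when H is trivial, so compatibility of scalars with products is stated
    separately, in [bscaleAl] and [bscaleAr]. *)
Record bop := Bop { bfun :> H -> H ; bfunP : bounded_ops H bfun }.

HB.instance Definition _ := gen_eqMixin bop.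
HB.instance Definition _ := gen_choiceMixin bop.

Implicit Types S T U : bop.

Lemma bop_ext S T : (forall x, S x = T x) -> S = T.
Proof.
case: S T => s sP [t tP] /= /funext st; subst t; congr Bop; exact: Prop_irrelevance.
Qed.

Lemma bopP T c x y : T (c *: x + y) = c *: T x + T y.
Proof. by case: (bfunP T) => + _; apply. Qed.
Lemma bopD T x y : T (x + y) = T x + T y.
Proof. by rewrite -[x]scale1r bopP !scale1r. Qed.
Lemma bop0 T : T 0 = 0.
Proof. by apply: (addrI (T 0)); rewrite -bopD !addr0. Qed.
Lemma bopZ T c x : T (c *: x) = c *: T x.
Proof. by rewrite -[c *: x]addr0 bopP bop0 addr0. Qed.
Lemma bopN T x : T (- x) = - T x.
Proof. by rewrite -scaleN1r bopZ scaleN1r. Qed.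
Lemma bop_bounded T : hbounded T.
Proof. by have /bounded_opsP[] := bfunP T. Qed.

Lemma mk_bop_subproof f : (forall c x y, f (c *: x + y) = c *: f x + f y) ->
  hbounded f -> bounded_ops H f.
Proof. by move=> lf bf; apply/bounded_opsP. Qed.
Definition mk_bop f lf bf := Bop (@mk_bop_subproof f lf bf).

Lemma bop_add_subproof S T : bounded_ops H (fun x => S x + T x).
Proof.
apply: mk_bop_subproof => [c x y|]; first by rewrite !bopP scalerDr addrACA.
have [[C C0 hC] [D D0 hD]] := (bop_bounded S, bop_bounded T).
exists (C + D) => [|x]; first exact: addr_ge0.
by apply: le_trans (hnormD _ _) _; rewrite mulrDl lerD.
Qed.
Definition bop_add S T := Bop (bop_add_subproof S T).

Lemma hnormZc (c : R[i]) x : hnorm (c *: x) = complex.Re `|c| * hnorm x.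
Proof.
apply: (@complexI R); rewrite rmorphM /= -!normr_hnorm. rewrite (RRe_real (normr_real c)).
by rewrite normrZ.
Qed.

Lemma bop_scale_subproof (c : R[i]) T : bounded_ops H (fun x => c *: T x).
Proof.
apply: mk_bop_subproof => [d x y|].
  by rewrite bopP scalerDr !scalerA mulrC.
have [C C0 hC] := bop_bounded T.
have c0 : 0 <= complex.Re `|c|.
  by have := normr_ge0 c; rewrite lecE => /andP[].
exists (complex.Re `|c| * C) => [|x]; first exact: mulr_ge0.
by rewrite hnormZc -mulrA ler_wpM2l.
Qed.
Definition bop_scale c T := Bop (bop_scale_subproof c T).

Lemma bop_opp_subproof T : bounded_ops H (fun x => - T x).
Proof.
apply: mk_bop_subproof => [d x y|]; first by rewrite bopP opprD scalerN.
have [C C0 hC] := bop_bounded T.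
by exists C => // x; rewrite hnormN.
Qed.
Definition bop_opp T := Bop (bop_opp_subproof T).

Lemma bop_zero_subproof : bounded_ops H (fun x => 0).
Proof.
apply: mk_bop_subproof => [d x y|]; first by rewrite scaler0 addr0.
by exists 0 => // x; rewrite hnorm0 mul0r.
Qed.
Definition bop_zero := Bop bop_zero_subproof.

Lemma bop_one_subproof : bounded_ops H idfun.
Proof.
by apply: mk_bop_subproof => [d x y //|]; exists 1 => // x; rewrite mul1r.
Qed.
Definition bop_one := Bop bop_one_subproof.

Lemma bop_mul_subproof S T : bounded_ops H (S \o T).
Proof.
apply: mk_bop_subproof => [c x y /=|]; first by rewrite !bopP.
have [[C C0 hC] [D D0 hD]] := (bop_bounded S, bop_bounded T).
exists (C * D) => [|x]; first exact: mulr_ge0.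
by apply: le_trans (hC _) _; rewrite -mulrA ler_wpM2l.
Qed.
Definition bop_mul S T := Bop (bop_mul_subproof S T).

Lemma bop_addA : associative bop_add.
Proof. by move=> S T U; apply: bop_ext => x /=; rewrite addrA. Qed.
Lemma bop_addC : commutative bop_add.
Proof. by move=> S T; apply: bop_ext => x /=; rewrite addrC. Qed.
Lemma bop_add0 : left_id bop_zero bop_add.
Proof. by move=> S; apply: bop_ext => x /=; rewrite add0r. Qed.
Lemma bop_addN : left_inverse bop_zero bop_opp bop_add.
Proof. by move=> S; apply: bop_ext => x /=; rewrite addNr. Qed.
HB.instance Definition _ := GRing.isZmodule.Build bop bop_addA bop_addC bop_add0 bop_addN.

Lemma bop_mulA : associative bop_mul.
Proof. by move=> S T U; apply: bop_ext. Qed.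
Lemma bop_mul1 : left_id bop_one bop_mul.
Proof. by move=> S; apply: bop_ext. Qed.
Lemma bop_mulr1 : right_id bop_one bop_mul.
Proof. by move=> S; apply: bop_ext. Qed.
Lemma bop_mulDl : left_distributive bop_mul bop_add.
Proof. by move=> S T U; apply: bop_ext. Qed.
Lemma bop_mulDr : right_distributive bop_mul bop_add.
Proof. by move=> S T U; apply: bop_ext => x /=; rewrite bopD. Qed.
HB.instance Definition _ := GRing.Zmodule_isPzRing.Build bop
  bop_mulA bop_mul1 bop_mulr1 bop_mulDl bop_mulDr.

Lemma bop_scaleA a b T : bop_scale a (bop_scale b T) = bop_scale (a * b) T.
Proof. by apply: bop_ext => x /=; rewrite scalerA. Qed.
Lemma bop_scale1 : left_id 1 bop_scale.
Proof. by move=> T; apply: bop_ext => x /=; rewrite scale1r. Qed.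
Lemma bop_scaleDr : right_distributive bop_scale +%R.
Proof. by move=> a S T; apply: bop_ext => x /=; rewrite scalerDr. Qed.
Lemma bop_scaleDl T : {morph bop_scale^~ T : a b / a + b}.
Proof. by move=> a b; apply: bop_ext => x /=; rewrite scalerDl. Qed.
HB.instance Definition _ := GRing.Zmodule_isLmodule.Build R[i] bop
  bop_scaleA bop_scale1 bop_scaleDr bop_scaleDl.

Lemma bop_addE S T x : (S + T) x = S x + T x. Proof. by []. Qed.
Lemma bop_oppE T x : (- T) x = - T x. Proof. by []. Qed.
Lemma bop_mulE S T x : (S * T) x = S (T x). Proof. by []. Qed.
Lemma bop_scaleE c T x : (c *: T) x = c *: T x. Proof. by []. Qed.
Lemma bop_oneE x : (1 : bop) x = x. Proof. by []. Qed.
Lemma bop_zeroE x : (0 : bop) x = 0. Proof. by []. Qed.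
Definition bopE := (bop_addE, bop_oppE, bop_mulE, bop_scaleE, bop_oneE, bop_zeroE).
Definition bop_linE := (bopD, bopN, bopZ, bop0).
Definition innerE := (innerDl, innerDr, innerNl, innerNr, innerZl, innerZr, (@inner0l R H), (@inner0r R H)).

Lemma bscaleAl c S T : c *: (S * T) = (c *: S) * T.
Proof. exact: bop_ext. Qed.
Lemma bscaleAr c S T : c *: (S * T) = S * (c *: T).
Proof. by apply: bop_ext => x; rewrite !bopE bopZ. Qed.

Lemma inner_ext S T : (forall x y, inner (S x) y = inner (T x) y) -> S = T.
Proof.
move=> h; apply: bop_ext => x; apply/eqP; rewrite -subr_eq0; apply/eqP.
by apply: inner_self_eq0; rewrite innerDl innerNl h -innerNl -innerDl subrr inner0l.
Qed.

(** Riesz representation of x |-> <T x, y>: if n is orthogonal to the kernel of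
    this functional h and h n <> 0, then (h n) x - (h x) n lies in the kernel,
    and its orthogonality to n expresses h x as <x, z> with z a multiple of n. *)
Lemma adj_exists T : exists S : bop, forall x y, inner (T x) y = inner x (S y).
Proof.
have [C C0 hC] := bop_bounded T.
have riesz y : exists z, forall x, inner (T x) y = inner x z.
  pose M := [set x | inner (T x) y = 0].
  have sM : subspace M.
    split=> [|c u v]; first by rewrite /M /= bop0 inner0l.
    by rewrite /M /= bopP innerDl innerZl => -> ->; rewrite mulr0 addr0.
  have cM : hclosed M.
    have key w x : (forall e, 0 < e -> exists2 m, rip (T m) w = 0 & hnorm (x - m) <= e) ->
        rip (T x) w = 0.
      move=> h; apply/eqP; rewrite -normr_le0; apply/ler_addgt0Pl => e e0; rewrite addr0.
      have k0 : 0 < C * hnorm w + 1 by rewrite ltr_wpDl // mulr_ge0 ?hnorm_ge0.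
      have [m m0 hm] := h _ (divr_gt0 e0 k0).
      have -> : rip (T x) w = rip (T (x - m)) w by rewrite bopD bopN ripDl ripNl m0 oppr0 addr0.
      have bnd z : rip (T z) w <= C * hnorm z * hnorm w.
        by apply: le_trans (rip_le _ _) _; rewrite ler_wpM2r ?hnorm_ge0.
      have : `|rip (T (x - m)) w| <= C * hnorm (x - m) * hnorm w.
        rewrite ler_norml bnd andbT lerNl -ripNl -bopN; apply: le_trans (bnd _) _.
        by rewrite hnormN.
      move/le_trans; apply; rewrite mulrAC.
      have := ler_wpM2l (mulr_ge0 C0 (hnorm_ge0 w)) hm; move/le_trans; apply.
      rewrite mulrCA ger_pMr // ler_pdivrMr // mul1r; lra.
    move=> x hx; apply: inner_eq0.
      by apply: key => e /hx[m Mm le]; exists m => //; rewrite /rip Mm.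
    apply: key => e /hx[m Mm le]; exists m => //.
    by rewrite /rip innerZr Mm mulr0.
  have [Mfull|/existsNP[x0 nMx0]] := pselect (forall x, M x).
    by exists 0 => x; rewrite inner0r; exact: Mfull.
  have [m Mm orth] := projection_exists x0 sM cM.
  pose n := x0 - m.
  have fn : inner (T n) y != 0.
    apply/eqP => e; apply: nMx0; rewrite /M /= -[x0](subrK m) bopD innerDl e.
    by rewrite add0r; exact: Mm.
  have nn : inner n n != 0.
    by apply: contra_neq fn => /inner_self_eq0 ->; rewrite bop0 inner0l.
  exists (conjc (inner (T n) y / inner n n) *: n) => x.
  have Mu : M (inner (T n) y *: x - inner (T x) y *: n).
    by rewrite /M /= bopD bopN !bopZ innerDl innerNl !innerZl mulrC subrr.
  have := orth _ Mu; rewrite innerDr innerNr !innerZr => /eqP.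
  rewrite subr_eq0 => /eqP /(congr1 (@conjc _)).
  rewrite !rmorphM /= !conjcK -!innerC => E.
  by rewrite mulrAC E mulfK.
have [g gP] := choice riesz.
have glin c x y : g (c *: x + y) = c *: g x + g y.
  apply/eqP; rewrite -subr_eq0; apply/eqP; apply: inner_self_eq0.
  set z := (X in inner X _).
  by rewrite innerDr innerNr -gP !innerDr !innerZr !gP subrr.
have gb : hbounded g.
  exists C => // x; have [->|g0] := eqVneq (hnorm (g x)) 0.
    by rewrite mulr_ge0 ?hnorm_ge0.
  have gp : 0 < hnorm (g x) by rewrite lt_def g0 hnorm_ge0.
  rewrite -(ler_pM2l gp) -expr2 hnorm2 /rip -gP; apply: le_trans (rip_le _ _) _.
  by rewrite mulrA (mulrC _ C) ler_wpM2r ?hnorm_ge0.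
by exists (mk_bop glin gb).
Qed.

Definition adj T : bop := projT1 (cid (adj_exists T)).
Lemma adjP T x y : inner (T x) y = inner x (adj T y).
Proof. by rewrite /adj; case: cid. Qed.
Lemma adjPr T x y : inner x (T y) = inner (adj T x) y.
Proof. by rewrite innerC adjP -innerC. Qed.
Lemma adj_uniq S T : (forall x y, inner (T x) y = inner x (S y)) -> adj T = S.
Proof. by move=> h; apply: inner_ext => x y; rewrite -adjPr innerC h -innerC. Qed.

Lemma adjD S T : adj (S + T) = adj S + adj T.
Proof. by apply: adj_uniq => x y; rewrite !bopE innerDl innerDr !adjP. Qed.
Lemma adjZ c T : adj (c *: T) = conjc c *: adj T.
Proof. by apply: adj_uniq => x y; rewrite !bopE innerZl innerZr conjcK adjP. Qed.
Lemma adjN T : adj (- T) = - adj T.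
Proof. by apply: adj_uniq => x y; rewrite !bopE innerNl innerNr adjP. Qed.
Lemma adjM S T : adj (S * T) = adj T * adj S.
Proof. by apply: adj_uniq => x y; rewrite !bopE !adjP. Qed.
Lemma adjK T : adj (adj T) = T.
Proof. by apply: adj_uniq => x y; rewrite adjPr. Qed.
Lemma adj1 : adj 1 = 1. Proof. exact: adj_uniq. Qed.
Lemma adj0 : adj 0 = 0.
Proof. by apply: adj_uniq => x y; rewrite !bopE inner0l inner0r. Qed.

Lemma adjoint_adj T : adjoint T = adj T.
Proof.
apply: xget_unique; first by split; [exact: bfunP | exact: adjP].
move=> S [bS hS]; rewrite -[S]/(bfun (Bop bS)); congr bfun; symmetry.
exact: adj_uniq.
Qed.

End BoundedOps.
Arguments bop {R} H.

Lemma vec_ext (R : realType) (H : hilbertType R) (a b : H) :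
  (forall w, inner a w = inner b w) -> a = b.
Proof.
move=> h; apply/eqP; rewrite -subr_eq0; apply/eqP; apply: inner_self_eq0.
by rewrite innerDl innerNl h subrr.
Qed.

(** Identities between vectors, or between noncommutative polynomials in
    operators, become identities between scalars once paired with arbitrary
    vectors, which puts them within reach of [ring]. *)
Ltac vec_ring := apply: vec_ext => ?; rewrite ?innerE; ring.
Ltac op_ring := apply: inner_ext => ? ?; rewrite ?(bopE, bop_linE, innerE); ring.

(** * Positive operators *)

Section Positive.
Context (R : realType) (H : hilbertType R).
Implicit Types (x y z : H) (S T U : bop H) (r s : R).

Definition sa T := adj T = T.
Definition pos T := forall x, 0 <= inner (T x) x.
Definition scal r : bop H := r%:C *: (1 : bop H).

Lemma scalE r x : scal r x = r%:C *: x. Proof. by []. Qed.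
Lemma scalMl r T : scal r * T = r%:C *: T.
Proof. by rewrite /scal -bscaleAl mul1r. Qed.
Lemma scalMr r T : T * scal r = r%:C *: T.
Proof. by rewrite /scal -bscaleAr mulr1. Qed.
Lemma scalD r s : scal (r + s) = scal r + scal s.
Proof. by rewrite /scal rmorphD scalerDl. Qed.
Lemma scalN r : scal (- r) = - scal r.
Proof. by rewrite /scal rmorphN scaleNr. Qed.
Lemma scalM r s : scal (r * s) = scal r * scal s.
Proof. by rewrite scalMl /scal scalerA rmorphM. Qed.
Lemma scal0 : scal 0 = 0. Proof. by rewrite /scal scale0r. Qed.
Lemma scal1 : scal 1 = 1. Proof. by rewrite /scal scale1r. Qed.
Lemma scal_comm r T : scal r * T = T * scal r.
Proof. by rewrite scalMl scalMr. Qed.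

(** Polarization; the scalars have to be complex. *)
Lemma form_eq0 T : (forall x, inner (T x) x = 0) -> T = 0.
Proof.
move=> h; apply: inner_ext => x y; rewrite bopE inner0l.
have h1 := h (x + y); have h2 := h (x + 'i *: y).
move: h1 h2; rewrite !bop_linE !innerE !h !(mulr0, addr0, add0r) => h1 h2.
have i2 : 'i * 'i = -1 :> R[i] by rewrite -expr2 sqr_i.
have e : conjc 'i = - 'i :> R[i] by apply/eqP; rewrite eq_complex /= oppr0 !eqxx.
move: h2; rewrite e mulNr addrC => /eqP; rewrite subr_eq0 => /eqP.
have i0 : 'i != 0 :> R[i] by rewrite eq_complex /= oner_eq0 andbF.
move/(mulfI i0) => h2; move: h1; rewrite h2 -mulr2n => /eqP.
by rewrite mulrn_eq0 /= => /eqP.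
Qed.

Lemma saP T : sa T <-> forall x y, rip (T x) y = rip x (T y).
Proof.
split=> [h x y|h]; first by rewrite /rip adjP h.
by apply: adj_uniq => x y; rewrite !inner_riP !h bopZ.
Qed.

Lemma pos_sa T : pos T -> sa T.
Proof.
move=> pT; apply/eqP; rewrite -subr_eq0; apply/eqP; apply: form_eq0 => x.
rewrite !bopE innerDl innerNl -adjPr innerC.
have /ger0_real : 0 <= inner (T x) x by [].
by case: (inner (T x) x) => a b; rewrite complex_real => /eqP -> /=; rewrite oppr0 subrr.
Qed.

Lemma sa_rip T x : sa T -> inner (T x) x = (rip (T x) x)%:C.
Proof.
move=> h; rewrite /rip; have := innerC (T x) x; rewrite -{1}h -adjP.
by case: (inner (T x) x) => a b /= [] /eqP; rewrite -addr_eq0 -mulr2n mulrn_eq0 => /eqP ->.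
Qed.

Lemma posP T : pos T <-> sa T /\ forall x, 0 <= rip (T x) x.
Proof.
split=> [pT|[sT h] x]; last by rewrite sa_rip // ler0c.
by split=> [|x]; [exact: pos_sa | have := pT x; rewrite sa_rip ?ler0c //; exact: pos_sa].
Qed.
Lemma pos_rip T x : pos T -> 0 <= rip (T x) x. Proof. by move/posP => [_]. Qed.

Lemma saD S T : sa S -> sa T -> sa (S + T).
Proof. by rewrite /sa adjD => -> ->. Qed.
Lemma saN T : sa T -> sa (- T).
Proof. by rewrite /sa adjN => ->. Qed.
Lemma saB S T : sa S -> sa T -> sa (S - T).
Proof. by move=> sS sT; apply: saD => //; apply: saN. Qed.
Lemma saZ r T : sa T -> sa (r%:C *: T).
Proof. by rewrite /sa adjZ conjc_real => ->. Qed.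
Lemma sa1 : sa 1. Proof. exact: adj1. Qed.
Lemma sa0 : sa 0. Proof. exact: adj0. Qed.
Lemma sa_scal r : sa (scal r). Proof. by apply: saZ; exact: sa1. Qed.
Lemma saM S T : sa S -> sa T -> S * T = T * S -> sa (S * T).
Proof. by rewrite /sa adjM => -> -> ->. Qed.

Lemma posD S T : pos S -> pos T -> pos (S + T).
Proof. by move=> pS pT x; rewrite bopE innerDl addr_ge0. Qed.
Lemma posZ r T : 0 <= r -> pos T -> pos (r%:C *: T).
Proof. by move=> r0 pT x; rewrite bopE innerZl mulr_ge0 ?ler0c. Qed.
Lemma pos1 : pos 1. Proof. by move=> x; exact: inner_ge0. Qed.
Lemma pos0 : pos 0. Proof. by move=> x; rewrite bopE inner0l. Qed.
Lemma pos_scal r : 0 <= r -> pos (scal r).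
Proof. by move=> r0; apply: posZ => //; exact: pos1. Qed.
Lemma pos_conj T S : pos T -> pos (adj S * T * S).
Proof. by move=> pT x; rewrite !bopE -adjPr; exact: pT. Qed.
Lemma pos_adjM T : pos (adj T * T).
Proof. by move=> x; rewrite !bopE -adjPr; exact: inner_ge0. Qed.
Lemma pos_sq T : sa T -> pos (T * T).
Proof. by move=> sT; rewrite -{1}sT; exact: pos_adjM. Qed.
Lemma pos_sconj T S : sa S -> pos T -> pos (S * T * S).
Proof. by move=> sS pT; rewrite -{1}sS; exact: pos_conj. Qed.

Lemma sa_sym T x y : sa T -> rip (T x) y = rip (T y) x.
Proof. by move=> /saP ->; rewrite ripC. Qed.

Lemma pos_CS T x y : pos T -> rip (T x) y ^+ 2 <= rip (T x) x * rip (T y) y.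
Proof.
move=> pT; apply: discriminant_le => [|t]; first exact: pos_rip.
have := pos_rip (x + t%:C *: y) pT; rewrite !bop_linE !ripE.
by rewrite (sa_sym y x (pos_sa pT)); lra.
Qed.

Lemma pos_form0 T x : pos T -> rip (T x) x = 0 -> T x = 0.
Proof.
move=> pT e; apply: rip_eq0; apply/eqP; rewrite -sqrf_eq0 eq_le sqr_ge0 andbT.
by have := pos_CS x (T x) pT; rewrite e mul0r.
Qed.

Lemma pos_antisym T : pos T -> pos (- T) -> T = 0.
Proof.
move=> p q; apply: bop_ext => x; rewrite bopE; apply: pos_form0 => //.
have := pos_rip x p; have := pos_rip x q; rewrite bopE ripNl; lra.
Qed.
Lemma ble_antisym S T : pos (S - T) -> pos (T - S) -> S = T.
Proof.
by move=> p q; apply/eqP; rewrite -subr_eq0; apply/eqP; apply: pos_antisym => //; rewrite opprB.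
Qed.

Lemma adjM_eq0 T : adj T * T = 0 -> T = 0.
Proof.
move=> e; apply: bop_ext => x; rewrite bopE; apply: inner_self_eq0.
by rewrite adjP -bop_mulE e bopE inner0r.
Qed.
Lemma sa_sq_eq0 T : sa T -> T * T = 0 -> T = 0.
Proof. by move=> sT e; apply: adjM_eq0; rewrite sT. Qed.

(** Apply [pos_CS] to x and T x. *)
Lemma pos_bound T r x : 0 <= r -> pos T -> pos (scal r - T) -> hnorm (T x) <= r * hnorm x.
Proof.
move=> r0 pT pr; have [->|y0] := eqVneq (hnorm (T x)) 0.
  by rewrite mulr_ge0 ?hnorm_ge0.
have yp : 0 < hnorm (T x) by rewrite lt_def y0 hnorm_ge0.
rewrite -(@ler_pXn2r _ 2) ?nnegrE ?mulr_ge0 ?hnorm_ge0 //.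
rewrite -(ler_pM2l (exprn_gt0 2 yp)).
have le z : rip (T z) z <= r * hnorm z ^+ 2.
  by have := pos_rip z pr; rewrite !bopE !ripE -hnorm2; lra.
have := pos_CS x (T x) pT; rewrite -hnorm2 => /le_trans h.
rewrite -expr2; apply: h; rewrite exprMn.
have -> : hnorm (T x) ^+ 2 * (r ^+ 2 * hnorm x ^+ 2) =
  (r * hnorm x ^+ 2) * (r * hnorm (T x) ^+ 2) by ring.
by apply: ler_pM; rewrite ?pos_rip.
Qed.

Lemma bound_le T r : sa T -> (forall x, hnorm (T x) <= r * hnorm x) -> pos (scal r - T).
Proof.
move=> sT h; apply/posP; split; first by apply: saB => //; exact: sa_scal.
move=> x; rewrite !bopE !ripE subr_ge0 -hnorm2; apply: le_trans (rip_le _ _) _.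
by rewrite expr2 mulrA ler_wpM2r ?hnorm_ge0.
Qed.

Lemma sa_bounded T : sa T -> exists2 r, 0 < r & pos (scal r - T) /\ pos (scal r + T).
Proof.
move=> sT; have [C C0 hC] := bop_bounded T; exists (C + 1); first by lra.
have hC' x : hnorm (T x) <= (C + 1) * hnorm x.
  by apply: le_trans (hC x) _; rewrite ler_wpM2r ?hnorm_ge0 //; lra.
split; first exact: bound_le.
by rewrite -[T]opprK; apply: bound_le => [|x]; [exact: saN | rewrite bopE hnormN].
Qed.

End Positive.

(** * Pointwise limits and the square root iteration *)

Section Limits.
Context (R : realType) (H : hilbertType R).
Implicit Types (x y z : H) (S T U : bop H) (r s : R) (u v : nat -> H).

Definition hlim u l := forall e : R, 0 < e -> exists N, forall n, (N <= n)%N -> hnorm (u n - l) <= e.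

Lemma hlim_uniq u l l' : hlim u l -> hlim u l' -> l = l'.
Proof.
move=> h h'; apply/eqP; rewrite -subr_eq0; apply/eqP; apply: hnorm_small => e e0.
have e2 : 0 < e / 2 by lra.
have [[N P] [N' P']] := (h _ e2, h' _ e2).
have := P _ (leq_maxl N N'); have := P' _ (leq_maxr N N').
set n := maxn _ _ => a b.
have -> : l - l' = (u n - l') + (l - u n) by vec_ring.
by apply: le_trans (hnormD _ _) _; rewrite (hnormB l); lra.
Qed.

Lemma hlim_eventually u v l : hlim u l -> (exists N, forall n, (N <= n)%N -> u n = v n) -> hlim v l.
Proof.
move=> h [N P] e /h[N' P']; exists (maxn N N') => n.
by rewrite geq_max => /andP[a b]; rewrite -P // P'.
Qed.

Lemma hlimS u l : hlim u l -> hlim (u \o S) l.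
Proof. by move=> h e /h[N P]; exists N => n Nn; apply: P; rewrite leqW. Qed.

Lemma hlimD u v l m : hlim u l -> hlim v m -> hlim (fun n => u n + v n) (l + m).
Proof.
move=> h h' e e0; have e2 : 0 < e / 2 by lra.
have [[N P] [N' P']] := (h _ e2, h' _ e2).
exists (maxn N N') => n; rewrite geq_max => /andP[a b].
rewrite opprD addrACA; apply: le_trans (hnormD _ _) _.
by have := P _ a; have := P' _ b; lra.
Qed.

Lemma hlim_const l : hlim (fun=> l) l.
Proof. by move=> e e0; exists 0%N => n _; rewrite subrr hnorm0 ltW. Qed.

Lemma hlim_lip u l (f : H -> H) C : 0 <= C ->
  (forall x y, hnorm (f x - f y) <= C * hnorm (x - y)) ->
  hlim u l -> hlim (fun n => f (u n)) (f l).
Proof.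
move=> C0 fC h e e0; have C1 : 0 < C + 1 by lra.
have [N P] := h _ (divr_gt0 e0 C1); exists N => n Nn.
apply: le_trans (fC _ _) _.
have := P n Nn; rewrite ler_pdivlMr // mulrDr mulr1.
have := hnorm_ge0 (u n - l); lra.
Qed.

Lemma hlim_bop T u l : hlim u l -> hlim (fun n => T (u n)) (T l).
Proof.
have [C C0 hC] := bop_bounded T; apply: (hlim_lip C0) => x y.
by rewrite -bopN -bopD.
Qed.

Lemma hlim_scale (c : R[i]) u l : hlim u l -> hlim (fun n => c *: u n) (c *: l).
Proof. exact: (hlim_bop (c *: (1 : bop H))). Qed.

Lemma hlim_norm_le u l C : hlim u l -> (forall n, hnorm (u n) <= C) -> hnorm l <= C.
Proof.
move=> h b; apply/ler_addgt0Pl => e e0; have [N P] := h _ e0.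
have -> : l = u N + (l - u N) by vec_ring.
apply: le_trans (hnormD _ _) _; rewrite (hnormB l).
by have := P _ (leqnn N); have := b N; lra.
Qed.

Lemma hlim_rip u l y : hlim u l -> forall e, 0 < e ->
  exists N, forall n, (N <= n)%N -> `|rip (u n) y - rip l y| <= e.
Proof.
move=> h e e0; have k0 : 0 < hnorm y + 1 by have := hnorm_ge0 y; lra.
have [N P] := h _ (divr_gt0 e0 k0); exists N => n /P.
have <- : rip (u n - l) y = rip (u n) y - rip l y by rewrite !ripE.
have bnd z : rip z y <= hnorm z * hnorm y by exact: rip_le.
rewrite ler_pdivlMr // mulrDr mulr1 => le; have g := hnorm_ge0 (u n - l).
rewrite ler_norml lerNl -ripNl; apply/andP; split.
  by apply: le_trans (bnd _) _; rewrite hnormN; lra.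
by apply: le_trans (bnd _) _; lra.
Qed.

Lemma hlim_rip_eq u v l m x y : hlim u l -> hlim v m ->
  (forall n, rip (u n) y = rip (v n) x) -> rip l y = rip m x.
Proof.
move=> h h' E; apply/eqP; rewrite -subr_eq0 -normr_le0; apply/ler_addgt0Pl => e e0.
have e2 : 0 < e / 2 by lra.
have [[N P] [N' P']] := (hlim_rip y h e2, hlim_rip x h' e2).
have := P _ (leq_maxl N N'); have := P' _ (leq_maxr N N').
rewrite E !ler_norml addr0; set n := rip (v _) x; lra.
Qed.
End Limits.

Section SquareRoot.
Context (R : realType) (H : hilbertType R).
Implicit Types (x y z : H) (S T U : bop H) (r s : R) (u v : nat -> H).

Lemma half_sq_diff (X S T : bop H) : T * S = S * T ->
  (2^-1)%:C *: (X + S * S) - (2^-1)%:C *: (X + T * T) =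
  (2^-1)%:C *: ((S - T) * (S + T)).
Proof. by move=> c; rewrite mulrBl !mulrDr c; op_ring. Qed.

Section Iteration.
Variable T : bop H.
Hypotheses (T0 : pos T) (T1 : pos (1 - T)).
Let X := 1 - T.

(** If S is the square root of T, then Y = 1 - S solves Y = (X + Y^2) / 2 with
    X = 1 - T. The iteration from 0 converges pointwise because it is dominated
    by the same iteration on real numbers with X replaced by its norm bound 1. *)
Fixpoint sq_iter n : bop H := 
  if n is m.+1 then (2^-1)%:C *: (X + sq_iter m * sq_iter m) else 0.
Fixpoint sq_bound n : R := if n is m.+1 then 2^-1 * (1 + sq_bound m ^+ 2) else 0.

Lemma sq_iterS n : sq_iter n.+1 = (2^-1)%:C *: (X + sq_iter n * sq_iter n).
Proof. by []. Qed.
Lemma sq_boundS n : sq_bound n.+1 = 2^-1 * (1 + sq_bound n ^+ 2).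
Proof. by []. Qed.

Lemma sq_iter_comm S n : S * T = T * S -> S * sq_iter n = sq_iter n * S.
Proof.
move=> c; elim: n => [|n IH] /=; first by rewrite mulr0 mul0r.
rewrite -bscaleAl -bscaleAr mulrDr mulrDl; congr (_ *: (_ + _)).
  by rewrite /X mulrBl mulrBr mulr1 mul1r c.
by rewrite mulrA IH -mulrA IH mulrA.
Qed.

Lemma sq_iter_comm2 m n : sq_iter m * sq_iter n = sq_iter n * sq_iter m.
Proof. by apply: sq_iter_comm; symmetry; apply: sq_iter_comm. Qed.

Lemma sq_iter_sa n : sa (sq_iter n).
Proof.
elim: n => [|n IH] /=; first exact: sa0.
apply: saZ; apply: saD; last exact: saM.
by apply: saB; [exact: sa1 | exact: pos_sa].
Qed.

Lemma sq_bound_ge0 n : 0 <= sq_bound n.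
Proof. by case: n => //= n; rewrite mulr_ge0 ?invr_ge0 // addr_ge0 ?sqr_ge0. Qed.
Lemma sq_bound_le1 n : sq_bound n <= 1.
Proof.
elim: n => //= n IH; have : sq_bound n ^+ 2 <= 1 by rewrite expr_le1 ?sq_bound_ge0.
lra.
Qed.

Lemma sq_iter_bound n x : hnorm (sq_iter n x) <= sq_bound n * hnorm x.
Proof.
elim: n x => [|n IH] x; first by rewrite bopE hnorm0 mul0r.
rewrite sq_iterS sq_boundS bopE hnormZ !bopE ger0_norm ?invr_ge0 // -mulrA ler_pM2l ?invr_gt0 //.
apply: le_trans (hnormD _ _) _; rewrite mulrDl mul1r; apply: lerD.
  have := @pos_bound _ _ X 1 x ler01 T1.
  by rewrite mul1r !bopE; apply; rewrite scal1 /X opprB addrC subrK.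
apply: le_trans (IH _) _; rewrite expr2 -mulrA.
by rewrite ler_wpM2l ?sq_bound_ge0.
Qed.

Lemma sq_bound_step n : 0 <= sq_bound n.+1 - sq_bound n.
Proof. by have := sqr_ge0 (1 - sq_bound n); rewrite /=; lra. Qed.

Lemma sq_iter_step n x :
  hnorm ((sq_iter n.+1 - sq_iter n) x) <= (sq_bound n.+1 - sq_bound n) * hnorm x.
Proof.
elim: n x => [|n IH] x.
  by rewrite !subr0 sq_iter_bound.
have -> : sq_iter n.+2 - sq_iter n.+1 =
    (2^-1)%:C *: ((sq_iter n.+1 - sq_iter n) * (sq_iter n.+1 + sq_iter n)).
  exact: (@half_sq_diff X (sq_iter n.+1) (sq_iter n) (sq_iter_comm2 _ _)).
rewrite bopE hnormZ ger0_norm ?invr_ge0 // bop_mulE.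
have -> : sq_bound n.+2 - sq_bound n.+1 =
    2^-1 * ((sq_bound n.+1 - sq_bound n) * (sq_bound n.+1 + sq_bound n)).
  by rewrite [sq_bound n.+2]sq_boundS {2}[sq_bound n.+1]sq_boundS; field.
rewrite -!mulrA ler_pM2l ?invr_gt0 //; apply: le_trans (IH _) _.
rewrite ler_wpM2l ?sq_bound_step // bopE; apply: le_trans (hnormD _ _) _.
by rewrite mulrDl; apply: lerD; apply: sq_iter_bound.
Qed.

Lemma sq_iter_dist n k x :
  hnorm (sq_iter (k + n) x - sq_iter n x) <= (sq_bound (k + n) - sq_bound n) * hnorm x.
Proof.
elim: k => [|k IH]; first by rewrite add0n !subrr hnorm0 mul0r.
rewrite addSn; set m := (k + n)%N in IH *.
have -> : sq_iter m.+1 x - sq_iter n x =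
  (sq_iter m.+1 - sq_iter m) x + (sq_iter m x - sq_iter n x).
  by rewrite !bopE addrA subrK.
apply: le_trans (hnormD _ _) _; have := sq_iter_step m x; move: IH.
rewrite !mulrBl; lra.
Qed.

Lemma sq_bound_cauchy (e : R) : 0 < e ->
  exists N, forall m n, (N <= n)%N -> (n <= m)%N -> sq_bound m - sq_bound n <= e.
Proof.
move=> e0; pose D := [set sq_bound n | n in setT].
have hD : has_sup D.
  by split; [exists (sq_bound 0), 0%N | exists 1 => _ [n _ <-]; exact: sq_bound_le1].
have [_ [N _ <-] lt] := sup_adherent e0 hD.
have mono m n : (n <= m)%N -> sq_bound n <= sq_bound m.
  move/subnK <-; elim: (m - n)%N => [|k IH]; first by rewrite add0n.
  by rewrite addSn; apply: le_trans IH _; rewrite -subr_ge0 sq_bound_step.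
exists N => m n Nn nm; have := mono _ _ Nn.
have : sq_bound m <= sup D by apply: ub_le_sup; [case: hD | exists m].
lra.
Qed.

(** The limit commutes with whatever commutes with T because the iterates are
    polynomials in T; this puts square roots inside von Neumann algebras. *)
Lemma sqrt_exists_unit : exists S : bop H,
  [/\ pos S, S * S = T & forall U, U * T = T * U -> U * S = S * U].
Proof.
have cv x : exists l, hlim (fun n => sq_iter n x) l.
  apply: hcomplete => e e0; have k0 : 0 < hnorm x + 1 by have := hnorm_ge0 x; lra.
  have [N NP] := sq_bound_cauchy (divr_gt0 e0 k0); exists N.
  have key n m : (N <= n)%N -> (n <= m)%N -> hnorm (sq_iter m x - sq_iter n x) <= e.
    move=> Nn nm; have := sq_iter_dist n (m - n) x; rewrite subnK //.
    move/le_trans; apply; have := NP m n Nn nm; have g := hnorm_ge0 x.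
    rewrite ler_pdivlMr // => le; apply: le_trans le; rewrite mulrDr mulr1 lerDl subr_ge0.
    rewrite -(subnK nm); elim: (m - n)%N => [|k IH]; first by rewrite add0n.
    by rewrite addSn; apply: le_trans IH _; rewrite -subr_ge0 sq_bound_step.
  move=> m n Nm Nn; have [nm|/ltnW mn] := leqP n m; first exact: key.
  by rewrite hnormB; apply: key.
have [f fP] := choice cv.
have flin c x y : f (c *: x + y) = c *: f x + f y.
  apply: (hlim_uniq (fP _)); apply: hlim_eventually (hlimD (hlim_scale c (fP x)) (fP y)) _.
  by exists 0%N => n _; rewrite bopP.
have fb1 x : hnorm (f x) <= hnorm x.
  apply: (hlim_norm_le (fP x)) => n; apply: le_trans (sq_iter_bound _ _) _.
  by apply: ler_piMl; rewrite ?hnorm_ge0 ?sq_bound_le1.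
have fb : hbounded f by exists 1 => // x; rewrite mul1r.
pose L := mk_bop flin fb.
have Lsa : sa L.
  apply/saP => x y; rewrite -[RHS]ripC; apply: (hlim_rip_eq (fP x) (fP y)) => n.
  by apply: sa_sym; exact: sq_iter_sa.
have LL x : hlim (fun n => sq_iter n (sq_iter n x)) (L (L x)).
  have h1 : hlim (fun n => sq_iter n (sq_iter n x - f x)) 0.
    move=> e e0; have [N NP] := fP x _ e0; exists N => n Nn.
    rewrite subr0; apply: le_trans (sq_iter_bound _ _) _.
    apply: le_trans (NP _ Nn); apply: ler_piMl; rewrite ?hnorm_ge0 ?sq_bound_le1 //.
  have := hlimD h1 (fP (f x)); rewrite add0r => h; apply: (hlim_eventually h).
  by exists 0%N => n _; rewrite bopD bopN subrK.
have LE : L = (2^-1)%:C *: (X + L * L).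
  apply: bop_ext => x; apply: (hlim_uniq (hlimS (fP x))).
  rewrite !bopE; have := hlim_scale (2^-1)%:C (hlimD (hlim_const (X x)) (LL x)).
  by move=> h; apply: (hlim_eventually h); exists 0%N => n _.
have L2 : L * L = 2%:C *: L - X.
  rewrite [in RHS]LE scalerA -rmorphM mulfV // scale1r addrC addrA addNr add0r //.
have comm U : U * T = T * U -> U * L = L * U.
  move=> c; apply: bop_ext => x; rewrite !bopE.
  apply: (hlim_uniq (hlim_bop U (fP x))); apply: hlim_eventually (fP (U x)) _.
  by exists 0%N => n _; rewrite -!bop_mulE sq_iter_comm.
exists (1 - L); split.
- rewrite -scal1; apply: bound_le => // x; by rewrite mul1r; exact: fb1.
- rewrite mulrBl mul1r mulrBr mulr1 L2 (_ : 2%:C = 2%:R) ?rmorph_nat // /X.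
  by op_ring.
- by move=> U /comm c; rewrite mulrBl mulrBr mulr1 mul1r c.
Qed.
End Iteration.
End SquareRoot.

(** * Square roots, inverses, and growth of powers *)

Section SqrtInverse.
Context (R : realType) (H : hilbertType R).
Implicit Types (x y z : H) (S T U : bop H) (r s : R) (u v : nat -> H).

Lemma sqrt_exists T : pos T -> exists S : bop H,
  [/\ pos S, S * S = T & forall U, U * T = T * U -> U * S = S * U].
Proof.
move=> pT; have [C C0 [hC _]] := sa_bounded (pos_sa pT).
have Ci : 0 <= C^-1 by rewrite invr_ge0 ltW.
have p1 : pos (C^-1%:C *: T) by apply: posZ.
have p2 : pos (1 - C^-1%:C *: T).
  have -> : 1 - C^-1%:C *: T = C^-1%:C *: (scal H C - T).
    by rewrite scalerBr /scal scalerA -rmorphM mulVf ?gt_eqF // scale1r.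
  exact: posZ.
have [S [pS SS cS]] := sqrt_exists_unit p1 p2.
have cc : (Num.sqrt C)%:C * (Num.sqrt C)%:C = C%:C :> R[i].
  by rewrite -rmorphM -expr2 sqr_sqrtr // ltW.
exists ((Num.sqrt C)%:C *: S); split.
- by apply: posZ => //; exact: sqrtr_ge0.
- rewrite -bscaleAl -bscaleAr SS !scalerA cc -rmorphM mulfV ?gt_eqF // scale1r //.
- move=> U c; rewrite -bscaleAl -bscaleAr cS // -bscaleAl -bscaleAr c //.
Qed.

(** A positive root S of T commutes with T, hence with the root Q constructed by
    iteration. On y = (S - Q) x the forms of S and Q then add up to 0, so both
    S and Q kill y, and (S - Q)^2 = 0. *)
Lemma sqrt_unique S S' : pos S -> pos S' -> S * S = S' * S' -> S = S'.
Proof.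
have main T U : pos T -> pos U -> T * T = U * U -> T * U = U * T -> T = U.
  move=> pT pU e c; apply/eqP; rewrite -subr_eq0; apply/eqP.
  have s : sa (T - U) by apply: saB; exact: pos_sa.
  apply: (sa_sq_eq0 s); apply: bop_ext => x; set y := (T - U) x.
  have E : rip (T y) y + rip (U y) y = 0.
    rewrite -ripDl -bop_addE /y -bop_mulE mulrDl !mulrBr e c addrA subrK subrr.
    by rewrite bopE rip0l.
  have [p q] := (pos_rip y pT, pos_rip y pU).
  have Ty : T y = 0 by apply: pos_form0 => //; lra.
  have Uy : U y = 0 by apply: pos_form0 => //; lra.
  by rewrite bop_mulE -/y !bopE Ty Uy subr0.
move=> pS pS' e; have [Q [pQ QQ cQ]] := sqrt_exists (pos_sq (pos_sa pS)).
have -> : S = Q by apply: main => //; apply: cQ; rewrite mulrA.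
by symmetry; apply: main; rewrite ?QQ //; apply: cQ; rewrite e mulrA.
Qed.

(** The default value 0 is reached only when T is not positive. *)
Definition bsqrt T : bop H := xget 0 [set S | pos S /\ S * S = T].

Lemma bsqrtP T : pos T -> [/\ pos (bsqrt T), bsqrt T * bsqrt T = T &
  forall U, U * T = T * U -> U * bsqrt T = bsqrt T * U].
Proof.
move=> pT; have [S [pS SS cS]] := sqrt_exists pT.
have : [set S | pos S /\ S * S = T] (bsqrt T) by apply: (@xgetPex _ 0); exists S.
move=> [p1 p2]; have e : bsqrt T = S by apply: sqrt_unique => //; rewrite p2.
by split=> //; rewrite e.
Qed.
Lemma bsqrt_pos T : pos T -> pos (bsqrt T). Proof. by case/bsqrtP. Qed.
Lemma bsqrt_sa T : pos T -> sa (bsqrt T). Proof. by move/bsqrt_pos/pos_sa. Qed.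
Lemma bsqrtK T : pos T -> bsqrt T * bsqrt T = T. Proof. by case/bsqrtP. Qed.
Lemma bsqrt_comm T U : pos T -> U * T = T * U -> U * bsqrt T = bsqrt T * U.
Proof. by case/bsqrtP => _ _; apply. Qed.
Lemma bsqrt_sq S : pos S -> bsqrt (S * S) = S.
Proof.
move=> pS; have [p e _] := bsqrtP (pos_sq (pos_sa pS)); exact: sqrt_unique.
Qed.
Lemma bsqrt_uniq S T : pos S -> S * S = T -> bsqrt T = S.
Proof. by move=> pS <-; exact: bsqrt_sq. Qed.

Lemma sqrt_opE T : pos T -> sqrt_op T = bsqrt T.
Proof.
move=> pT; have [p e _] := bsqrtP pT.
apply: xget_unique; first by split; [exact: bfunP | exact: p | rewrite -[in RHS]e].
move=> S [bS pS SS]; rewrite -[S]/(bfun (Bop bS)); congr bfun.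
by symmetry; apply: bsqrt_uniq => //; apply: bop_ext => x; rewrite -SS.
Qed.

Lemma pos_commM S T : pos S -> pos T -> S * T = T * S -> pos (S * T).
Proof.
move=> pS pT c; have -> : S * T = bsqrt S * T * bsqrt S.
  by rewrite -mulrA bsqrt_comm // mulrA bsqrtK.
by apply: pos_sconj => //; exact: bsqrt_sa.
Qed.

Lemma pos_le_norm T (e : R) x : pos (T - scal H e) -> e * hnorm x <= hnorm (T x).
Proof.
move=> p; have [->|x0] := eqVneq (hnorm x) 0; first by rewrite mulr0 hnorm_ge0.
have xp : 0 < hnorm x by rewrite lt_def x0 hnorm_ge0.
rewrite -(ler_pM2l xp); apply: le_trans (_ : rip (T x) x <= _).
  by have := pos_rip x p; rewrite !bopE !ripE -hnorm2; lra.
by rewrite mulrC; exact: rip_le.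
Qed.

(** T is bounded below, so its range is closed; a vector orthogonal to the range
    is in the kernel of the selfadjoint T, which is trivial. *)
Lemma inverse_exists T (e : R) : 0 < e -> sa T -> pos (T - scal H e) ->
  exists S : bop H, S * T = 1 /\ T * S = 1.
Proof.
move=> e0 sT pT; have lo x := pos_le_norm x pT.
have inj x y : T x = T y -> x = y.
  move=> E; apply/eqP; rewrite -subr_eq0; apply/eqP; apply: hnorm_eq0.
  apply/eqP; rewrite eq_le hnorm_ge0 andbT -(ler_pM2l e0) mulr0.
  by apply: le_trans (lo _) _; rewrite bopD bopN E subrr hnorm0.
pose M := [set y | exists x, y = T x].
have sM : subspace M.
  split=> [|c _ _ [x ->] [y ->]]; first by exists 0; rewrite bop0.
  by exists (c *: x + y); rewrite bopP.
have cM : hclosed M.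
  move=> y hy.
  have near n : exists x, hnorm (y - T x) <= (n.+1%:R)^-1.
    have n0 : 0 < (n.+1%:R)^-1 :> R by rewrite invr_gt0 ltr0n.
    by have [_ [x ->] h] := hy _ n0; exists x.
  have [u uP] := choice near.
  have [|l lP] := @hcomplete _ _ u.
    move=> d d0; have d1 : 0 < e * d / 2 by rewrite divr_gt0 // mulr_gt0.
    have [N NP] := invS_small d1; exists N => m n Nm Nn.
    rewrite -(ler_pM2l e0); apply: le_trans (lo _) _.
    have -> : T (u m - u n) = (y - T (u n)) - (y - T (u m)).
      by rewrite bopD bopN; vec_ring.
    apply: le_trans (hnormD _ _) _; rewrite hnormN.
    have := le_trans (uP m) (NP m Nm); have := le_trans (uP n) (NP n Nn); lra.
  exists l; apply: (@hlim_uniq _ _ (fun n => T (u n))); last exact: hlim_bop.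
  move=> d d0; have [N NP] := invS_small d0; exists N => n Nn.
  by rewrite hnormB; apply: le_trans (uP n) (NP n Nn).
have sur y : exists x, T x = y.
  have [_ [x ->] orth] := projection_exists y sM cM.
  exists x; apply/esym/eqP; rewrite -subr_eq0; apply/eqP; apply: inj; rewrite bop0.
  apply: inner_self_eq0; rewrite -{1}sT -adjPr.
  by apply: orth; exists (T (y - T x)).
have [g gP] := choice sur.
have glin c x y : g (c *: x + y) = c *: g x + g y.
  by apply: inj; rewrite bopP !gP.
have gb : hbounded g.
  exists e^-1 => [|x]; first by rewrite invr_ge0 ltW.
  by rewrite ler_pdivlMl // -{2}(gP x).
exists (mk_bop glin gb); split; apply: bop_ext => x; rewrite !bopE /=.
  by apply: inj; rewrite gP.
exact: gP.
Qed.

Lemma inverse_sa S T : sa T -> S * T = 1 -> T * S = 1 -> sa S.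
Proof.
move=> sT h1 h2; have e : adj S * T = 1 by rewrite -{1}sT -adjM h2 adj1.
by rewrite /sa -[adj S]mulr1 -h2 mulrA e mul1r.
Qed.
Lemma inverse_pos S T : pos T -> S * T = 1 -> T * S = 1 -> pos S.
Proof.
move=> pT h1 h2; have sS := inverse_sa (pos_sa pT) h1 h2.
by rewrite -[S]mul1r -h1; exact: pos_sconj.
Qed.
Lemma inverse_comm S T U : S * T = 1 -> T * S = 1 -> U * T = T * U -> U * S = S * U.
Proof.
by move=> h1 h2 c; rewrite -[U * S]mul1r -h1 -!mulrA (mulrA T) -c -!mulrA h2 mulr1.
Qed.

(** A geometric sequence with ratio above 1 outgrows every affine one. *)
Lemma pow2_growth r C : 0 <= r -> (forall j, r ^+ (2 ^ j) <= C * (2 ^ j).+1%:R) -> r <= 1.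
Proof.
move=> r0 h; rewrite leNgt; apply/negP => r1; pose d := r - 1.
have d0 : 0 < d by rewrite subr_gt0.
have bern n : 1 + n%:R * d <= r ^+ n.
  elim: n => [|n IH]; first by rewrite mul0r addr0 expr0.
  rewrite exprS -natr1; have n0 : 0 <= n%:R :> R by [].
  have -> : r = 1 + d by rewrite /d; lra.
  rewrite mulrDl mul1r; have : 1 <= r ^+ n by apply: exprn_ege1; exact: ltW.
  by rewrite {1}(_ : r = 1 + d) in IH *; [nra | rewrite /d; lra].
have C0 : 0 <= C.
  have := h 0%N; rewrite expn0 expr1; have : 0 < 2%:R :> R by []. nra.
have key j : (2 ^ j)%:R * d ^+ 2 <= 3 * C.
  have m0 : 0 < (2 ^ j)%:R :> R by rewrite ltr0n expn_gt0.
  have m1 : 1 <= (2 ^ j)%:R :> R by rewrite ler1n expn_gt0.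
  have := h j.+1; rewrite expnS mulnC exprM -natr1 natrM.
  have b := bern (2 ^ j)%N; set m := (2 ^ j)%:R in m0 m1 b *.
  set p := r ^+ (2 ^ j) in b *; move=> le.
  have g : (m * d) ^+ 2 <= p ^+ 2.
    by rewrite ler_pXn2r // ?nnegrE; nra.
  rewrite -(ler_pM2l m0).
  have -> : m * (m * d ^+ 2) = (m * d) ^+ 2 by ring.
  apply: le_trans g (le_trans le _).
  have : 0 <= C * (m - 1) by apply: mulr_ge0 => //; lra.
  lra.
have q0 : 0 <= 3 * C / d ^+ 2 by rewrite divr_ge0 ?sqr_ge0 // mulr_ge0.
have := archi_boundP q0; set n := Num.bound _ => lt.
have := key n; rewrite -ler_pdivlMr ?exprn_gt0 // => le.
have : n%:R <= (2 ^ n)%:R :> R by rewrite ler_nat ltnW // ltn_expl.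
lra.
Qed.

Definition normal T := adj T * T = T * adj T.
Lemma normal_norm T x : normal T -> hnorm (adj T x) = hnorm (T x).
Proof.
by move=> n; rewrite /hnorm /rip -adjPr [in RHS]adjP -!bop_mulE n.
Qed.
End SqrtInverse.

(** * Sequentially commuting effects commute *)

Section GudderNagy.
Context (R : realType) (H : hilbertType R).
Implicit Types (x y z : H) (S T U W N M P Q : bop H) (r s : R).

Lemma normal_sq_le M x : normal M -> hnorm (M x) ^+ 2 <= hnorm (M (M x)) * hnorm x.
Proof.
move=> nM; rewrite hnorm2 /rip adjP -/(rip _ _) mulrC -(normal_norm (M x) nM).
exact: rip_le.
Qed.

Lemma normal_pow2 M j : normal M -> normal (M ^+ (2 ^ j)).
Proof.
move=> nM; elim: j => [|j IH]; first by rewrite expr1.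
rewrite expnS mulnC exprM expr2; move: IH; set T := _ ^+ _ => nT.
rewrite /normal adjM; have c : GRing.comm T (adj T) by exact: esym.
by apply: commrM; apply: commr_sym; apply: commrM.
Qed.

Lemma normal_pow2_le M j x : normal M ->
  hnorm (M x) ^+ (2 ^ j) * hnorm x <= hnorm ((M ^+ (2 ^ j)) x) * hnorm x ^+ (2 ^ j).
Proof.
move=> nM; elim: j => [|j IH]; first by rewrite !expr1.
have [h0|h0] := eqVneq (hnorm x) 0.
  by rewrite h0 mulr0 mulr_ge0 ?hnorm_ge0 // exprn_ge0.
have hp : 0 < hnorm x by rewrite lt_def h0 hnorm_ge0.
rewrite expnS mulnC !exprM -(ler_pM2l hp).
have := normal_sq_le x (normal_pow2 j nM); rewrite -bop_mulE -expr2.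
move: IH; set a := _ ^+ (2 ^ j); set b := hnorm ((M ^+ _) x).
set d := hnorm x ^+ _ => IH le.
have a0 : 0 <= a by rewrite exprn_ge0 ?hnorm_ge0.
have d0 : 0 <= d by rewrite exprn_ge0 ?hnorm_ge0.
have -> : hnorm x * (a ^+ 2 * hnorm x) = (a * hnorm x) ^+ 2 by ring.
apply: le_trans (_ : (b * d) ^+ 2 <= _).
  by rewrite ler_pXn2r // nnegrE mulr_ge0 ?hnorm_ge0.
by rewrite exprMn [leRHS]mulrA (mulrC (hnorm x)) ler_wpM2r ?sqr_ge0.
Qed.

(** Intertwining bounds M^n on the range of W by c^n up to a constant factor.
    As M is normal, the bound passes to M by n-th roots, and the factor
    disappears in the limit. *)
Lemma normal_intertwined M W S c x : normal M -> M * W = W * S -> 0 < c ->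
  (forall z, hnorm (S z) <= c * hnorm z) -> hnorm (M (W x)) <= c * hnorm (W x).
Proof.
move=> nM MW c0 hS; have [D D0 hD] := bop_bounded W.
have [h0|h0] := eqVneq (hnorm (W x)) 0.
  by rewrite h0 (hnorm_eq0 h0) bop0 hnorm0 mulr0.
have hp : 0 < hnorm (W x) by rewrite lt_def h0 hnorm_ge0.
have powS n z : hnorm ((S ^+ n) z) <= c ^+ n * hnorm z.
  elim: n z => [|n IH] z; first by rewrite !expr0 mul1r.
  rewrite exprSr bop_mulE; apply: le_trans (IH _) _.
  by rewrite exprSr -mulrA ler_wpM2l ?exprn_ge0 // ltW.
have powM n : M ^+ n * W = W * S ^+ n.
  elim: n => [|n IH]; first by rewrite !expr0 mul1r mulr1.
  by rewrite exprSr -mulrA MW mulrA IH -mulrA -exprSr.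
have hch : 0 < c * hnorm (W x) by apply: mulr_gt0.
rewrite -[leRHS]mul1r -ler_pdivrMr //.
apply: (@pow2_growth _ _ (D * hnorm x / hnorm (W x))).
  by rewrite divr_ge0 ?hnorm_ge0 // ltW.
move=> j; have := normal_pow2_le j (W x) nM.
rewrite -[(M ^+ _) (W x)]bop_mulE powM bop_mulE; set n := (2 ^ j)%N => le.
have le2 : hnorm (M (W x)) ^+ n * hnorm (W x) <= D * hnorm x * (c * hnorm (W x)) ^+ n.
  apply: le_trans le _; rewrite exprMn [leRHS]mulrA ler_wpM2r ?exprn_ge0 ?hnorm_ge0 //.
  apply: le_trans (hD _) _; rewrite -[leRHS]mulrA ler_wpM2l //.
  by rewrite mulrC; rewrite mulrC [leRHS]mulrC; exact: powS.
have le3 : (hnorm (M (W x)) / (c * hnorm (W x))) ^+ n <= D * hnorm x / hnorm (W x).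
  by rewrite expr_div_n ler_pdivrMr ?exprn_gt0 // mulrAC ler_pdivlMr.
apply: le_trans le3 _; rewrite ler_peMr //; last by rewrite ler1n.
by rewrite divr_ge0 ?mulr_ge0 ?hnorm_ge0.
Qed.

(** The cross term vanishes as <S x, x> is real. *)
Lemma sa_shift_bound S (L C : R) x : sa S -> 0 <= C -> 
  (forall z, hnorm (S z) <= C * hnorm z) ->
  hnorm ((S - (L%:C * 'i) *: (1 : bop H)) x) <= Num.sqrt (C ^+ 2 + L ^+ 2) * hnorm x.
Proof.
move=> sS C0 hS.
apply: hnorm_sqr_le; first by rewrite mulr_ge0 ?hnorm_ge0 ?sqrtr_ge0.
rewrite exprMn sqr_sqrtr ?addr_ge0 ?sqr_ge0 //.
have e0 : rip (S x) ('i *: x) = 0.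
  rewrite sa_sym // bopZ.
  have := innerZl 'i (S x) x; rewrite /rip => ->; rewrite sa_rip //=.
  by rewrite mul0r mulr0 subrr.
have e1 : rip ('i *: x) ('i *: x) = rip x x.
  by rewrite /rip innerZl innerZr inner_rip /=; ring.
rewrite !bopE -scalerA !ripE e1 (ripC (S x)) e0 -!hnorm2.
have : hnorm (S x) ^+ 2 <= (C * hnorm x) ^+ 2.
  by rewrite ler_pXn2r ?nnegrE ?mulr_ge0 ?hnorm_ge0.
rewrite exprMn; lra.
Qed.

Lemma linear_bounded_eq0 (a b : R) : (forall L, L * a <= b) -> a = 0.
Proof.
move=> h; apply/eqP; apply/negPn/negP => a0.
by have := h ((b + 1) / a); rewrite divfK //; lra.
Qed.

(** N = P Q satisfies N W = W S with W = sqrt P and S = W Q W selfadjoint. So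
    N - i L inherits on the range of W the bound sqrt (C^2 + L^2) of S - i L,
    for all real L at once, which forces <N y, y> to be real there. The rest is
    algebra: normality gives N and its adjoint the same kernel, so that the
    difference D of the two, known to satisfy W D W = 0, is nilpotent. *)
Theorem pos_mul_normal P Q : pos P -> pos Q -> normal (P * Q) -> P * Q = Q * P.
Proof.
move=> pP pQ nN; set N := P * Q in nN *.
have NE : N = P * Q by []; clearbody N.
have [sP sQ] := (pos_sa pP, pos_sa pQ).
have aN : adj N = Q * P by rewrite NE adjM sP sQ.
set W := bsqrt P; have sW : sa W by exact: bsqrt_sa.
have WW : W * W = P by exact: bsqrtK.
set S := W * Q * W; have sS : sa S by apply: pos_sa; exact: pos_sconj.
have NW : N * W = W * S by rewrite NE /S -WW !mulrA.
have [C C0 hC] := bop_bounded S.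
have key y : (exists x, y = W x) -> rip (N y) ('i *: y) = 0.
  move=> [x yE]; apply: (@linear_bounded_eq0 _ (C ^+ 2 * rip y y / 2)) => L'.
  (* with this sign the term linear in L is the one to be bounded *)
  pose L := - L'; pose M := N - (L%:C * 'i) *: (1 : bop H).
  have aM : adj M = adj N + (L%:C * 'i) *: (1 : bop H).
    have ci : conjc (L%:C * 'i) = - (L%:C * 'i) :> R[i].
      by apply/eqP; rewrite eq_complex /=; apply/andP; split; apply/eqP; ring.
    by rewrite /M adjD adjN adjZ adj1 ci scaleNr opprK.
  have nM : normal M.
    rewrite /normal aM /M !mulrDl !mulrDr nN !mulrN !mulNr.
    rewrite -!bscaleAl -!bscaleAr !mul1r !mulr1; op_ring.
  have MW : M * W = W * (S - (L%:C * 'i) *: (1 : bop H)).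
    by rewrite /M mulrBl mulrBr NW -bscaleAl -bscaleAr mul1r mulr1.
  have [c0|c0] := eqVneq (C ^+ 2 + L ^+ 2) 0.
    have /eqP := c0; rewrite paddr_eq0 ?sqr_ge0 // !sqrf_eq0 => /andP[/eqP -> /eqP].
    rewrite /L => /eqP; rewrite oppr_eq0 => /eqP ->; rewrite expr0n !mul0r //.
  have cp : 0 < C ^+ 2 + L ^+ 2 by rewrite lt_def c0 addr_ge0 ?sqr_ge0.
  have cs : 0 < Num.sqrt (C ^+ 2 + L ^+ 2) by rewrite sqrtr_gt0.
  have := normal_intertwined x nM MW cs (fun z => sa_shift_bound L z sS C0 hC).
  rewrite -yE => le.
  have : hnorm (M y) ^+ 2 <= (Num.sqrt (C ^+ 2 + L ^+ 2) * hnorm y) ^+ 2.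
    by rewrite ler_pXn2r ?nnegrE ?mulr_ge0 ?hnorm_ge0 ?sqrtr_ge0.
  rewrite exprMn (sqr_sqrtr (ltW cp)).
  rewrite !hnorm2 /M !bopE -scalerA !ripE (ripC (N y)).
  have -> : rip ('i *: y) ('i *: y) = rip y y.
    by rewrite /rip innerZl innerZr inner_rip /=; ring.
  have := rip_ge0 (N y); rewrite /L; lra.
set D := N - adj N; have aD : adj D = - D.
  by rewrite /D adjD adjN adjK opprB addrC.
have WDW : W * D * W = 0.
  apply: form_eq0 => x; rewrite !bop_mulE -{1}sW -adjPr; set y := W x.
  rewrite /D !bopE innerDl innerNl -adjPr (innerC (N y) y) inner_riP key; last by exists x.
  by rewrite /= oppr0 subrr.
have nullE T x : N (T x) = 0 <-> adj N (T x) = 0.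
  have e := normal_norm (T x) nN.
  by split => E; apply: hnorm_eq0; rewrite ?e ?E ?hnorm0 // -e E hnorm0.
have nullM T : adj N * T = 0 -> N * T = 0.
  move=> E; apply: bop_ext => x; rewrite bop_mulE bop_zeroE; apply/nullE.
  by rewrite -bop_mulE E.
have PDP : P * D * P = 0.
  have -> : P * D * P = W * (W * D * W) * W by rewrite -WW !mulrA.
  by rewrite WDW mulr0 mul0r.
have NDP : adj N * (D * P) = 0 by rewrite aN -mulrA (mulrA P) PDP mulr0.
have DDP : D * (D * P) = 0 by rewrite {1}/D mulrBl NDP nullM // subrr.
have DP : D * P = 0.
  by apply: adjM_eq0; rewrite adjM aD sP mulrN mulNr -mulrA DDP mulr0 oppr0.
have PD : P * D = 0.
  by rewrite -[P * D]opprK -mulrN -aD -[in X in X * _]sP -adjM DP adj0 oppr0.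
have ND : adj N * D = 0 by rewrite aN -mulrA PD mulr0.
have DD : D * D = 0 by rewrite {1}/D mulrBl ND nullM // subrr.
have D0 : D = 0 by apply: adjM_eq0; rewrite aD mulNr DD oppr0.
by apply/eqP; rewrite -subr_eq0 -aN -/D D0.
Qed.

(** A theorem of Gudder and Nagy. The hypothesis says exactly that the product
    of sqrt S and sqrt T is normal. *)
Theorem seq_commute S T : pos S -> pos T ->
  bsqrt S * T * bsqrt S = bsqrt T * S * bsqrt T -> S * T = T * S.
Proof.
move=> pS pT E; set P := bsqrt S in E *; set Q := bsqrt T in E *.
have [pP pQ] : pos P /\ pos Q by split; exact: bsqrt_pos.
have c : P * Q = Q * P.
  apply: pos_mul_normal => //; rewrite /normal adjM (pos_sa pP) (pos_sa pQ).
  by rewrite !mulrA -(mulrA Q P P) bsqrtK // -E -(mulrA P Q Q) bsqrtK.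
by rewrite -(bsqrtK pS) -(bsqrtK pT) -/P -/Q -mulrA (mulrA P Q) c !mulrA c -!mulrA c (mulrA P Q) c !mulrA.
Qed.
End GudderNagy.

(** * Von Neumann algebras and factors *)

Section Algebras.
Context (R : realType) (H : hilbertType R).
Implicit Types (x y z : H) (S T U P Q a b : bop H) (r s t : R) (M : set (bop H)).

Definition centralizes M S := forall U, M U -> S * U = U * S.

(** [vna_bic] is the bicommutant property; it is how square roots, inverses and
    projections built on H are shown to belong to M. *)
Record vna M : Prop := Vna {
  vna1 : M 1 ;
  vnaP : forall (c : R[i]) S T, M S -> M T -> M (c *: S + T) ;
  vnaM : forall S T, M S -> M T -> M (S * T) ;
  vna_adj : forall T, M T -> M (adj T) ;
  vna_bic : forall T, (forall S, centralizes M S -> S * T = T * S) -> M T }.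

Definition scalar_op T := exists c : R[i], T = c *: (1 : bop H).

Record factor M : Prop := Factor {
  factor_vna : vna M ;
  factor_center : forall T, M T -> centralizes M T -> scalar_op T }.

Lemma vna_of (A : set (H -> H)) : von_neumann_algebra A -> vna [set T : bop H | A T].
Proof.
case=> bA A1 Al Am Aa Ab; split => /=.
- exact: A1.
- by move=> c S T; exact: Al.
- by move=> S T; exact: Am.
- by move=> T AT; rewrite -adjoint_adj; exact: Aa.
- move=> T h; rewrite -Ab; split; first exact: bfunP.
  move=> S [bS hS]; have := h (Bop bS); rewrite /centralizes => /(_ _)/(congr1 (@bfun R H)).
  apply=> U AU; apply: bop_ext => x.
  by have /(congr1 (fun f => f x)) := hS _ AU; rewrite /= => ->.
Qed.

Lemma factor_of (A : set (H -> H)) : vn_factor A -> factor [set T : bop H | A T].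
Proof.
move=> [vA cA]; split; first exact: vna_of.
move=> T AT cT; have : op_center A T.
  split=> //; split; first exact: bfunP.
  move=> S AS; have bS := vN_bounded vA AS.
  by have /(congr1 (@bfun R H)) := cT (Bop bS) AS.
rewrite cA => -[c _ e]; exists c; apply: bop_ext => x.
by rewrite -e.
Qed.

Section Theory.
Variable M : set (bop H).
Hypothesis vM : vna M.

Lemma vna0 : M 0.
Proof. by have := vnaP vM (-1) (vna1 vM) (vna1 vM); rewrite scaleN1r addNr. Qed.
Lemma vnaZ (c : R[i]) T : M T -> M (c *: T).
Proof. by move=> MT; rewrite -[_ *: _]addr0; apply: (vnaP vM) => //; exact: vna0. Qed.
Lemma vnaD S T : M S -> M T -> M (S + T).
Proof. by move=> MS MT; rewrite -[S]scale1r; exact: (vnaP vM). Qed.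
Lemma vnaN T : M T -> M (- T).
Proof. by move=> MT; rewrite -scaleN1r; exact: vnaZ. Qed.
Lemma vnaB S T : M S -> M T -> M (S - T).
Proof. by move=> MS MT; apply: vnaD => //; exact: vnaN. Qed.
Lemma vna_scal r : M (scal H r).
Proof. by apply: vnaZ; exact: (vna1 vM). Qed.

Lemma centralizes_adj S : centralizes M S -> centralizes M (adj S).
Proof.
by move=> h U MU; apply: (can_inj (@adjK _ _)); rewrite !adjM adjK h //; exact: (vna_adj vM).
Qed.

Lemma vna_sqrt T : M T -> pos T -> M (bsqrt T).
Proof.
by move=> MT pT; apply: (vna_bic vM) => // S cS; apply: bsqrt_comm => //; exact: cS.
Qed.
Lemma vna_inv S T : M T -> S * T = 1 -> T * S = 1 -> M S.
Proof.
by move=> MT h1 h2; apply: (vna_bic vM) => // U cU; apply: inverse_comm h1 h2 _; exact: cU.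
Qed.
End Theory.

Lemma proj_op (K : set H) : subspace K -> hclosed K ->
  exists P, [/\ sa P, P * P = P, forall x, K x <-> P x = x
    & forall S, (forall x, K x -> K (S x)) -> (forall x, K x -> K (adj S x)) -> S * P = P * S].
Proof.
move=> sK cK.
have near x : exists m, K m /\ forall y, K y -> inner (x - m) y = 0.
  by have [m Km hm] := projection_exists x sK cK; exists m.
have [g gP] := choice near.
have uniq x m : K m -> (forall y, K y -> inner (x - m) y = 0) -> g x = m.
  move=> Km hm; have [Kg hg] := gP x; apply/eqP; rewrite -subr_eq0; apply/eqP.
  apply: inner_self_eq0.
  have Kd : K (g x - m) by apply: subspaceD => //; exact: subspaceN.
  rewrite {1}(_ : g x - m = (x - m) - (x - g x)); last by vec_ring.
  by rewrite innerDl innerNl hm // hg // subr0.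
have glin c x y : g (c *: x + y) = c *: g x + g y.
  have [[Kx hx] [Ky hy]] := (gP x, gP y).
  apply: uniq => [|z Kz]; first by case: sK => _; apply.
  have -> : c *: x + y - (c *: g x + g y) = c *: (x - g x) + (y - g y).
    by rewrite scalerBr; vec_ring.
  by rewrite innerDl innerZl hx // hy // mulr0 addr0.
have gb : hbounded g.
  exists 1 => // x; rewrite mul1r hnorm_le; have [Kg hg] := gP x.
  have e : rip (x - g x) (g x) = 0 by rewrite /rip hg.
  have -> : rip x x = rip (x - g x + g x) (x - g x + g x) by rewrite subrK.
  move: (x - g x) e => u e.
  by rewrite ripDl !ripDr (ripC u (g x)) e add0r addr0 lerDr rip_ge0.
pose P := mk_bop glin gb.
have PK x : K (P x) by have [] := gP x.
have KP x : K x -> P x = x.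
  by move=> Kx; apply: uniq => // y _; rewrite subrr inner0l.
have sP : sa P.
  apply: adj_uniq => x y; have [_ hx] := gP x; have [_ hy] := gP y.
  have := hx _ (PK y); have := hy _ (PK x); rewrite -/(P x) -/(P y) !innerDl !innerNl.
  move=> /eqP; rewrite subr_eq0 => /eqP e1 /eqP; rewrite subr_eq0 => /eqP e2.
  by rewrite e2 innerC e1 -innerC.
exists P; split => //.
- by apply: bop_ext => x; rewrite bopE; apply: KP.
- by move=> x; split=> [/KP //|<-].
- move=> S hS hS'; apply: bop_ext => x; rewrite !bopE; symmetry.
  apply: uniq => [|y Ky]; first exact: hS.
  by rewrite -bopN -bopD adjP; have [_ ->] := gP x; last exact: hS'.
Qed.

Lemma ker_subspace T : subspace [set x | T x = 0].
Proof.
split=> [|c x y]; first by rewrite /= bop0.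
by rewrite /= bopP => -> ->; rewrite scaler0 addr0.
Qed.
Lemma ker_closed T : hclosed [set x | T x = 0].
Proof.
move=> x h; apply: hnorm_small => e e0; have [C C0 hC] := bop_bounded T.
have C1 : 0 < C + 1 by lra.
have [m /= Tm le] := h _ (divr_gt0 e0 C1).
have -> : T x = T (x - m) by rewrite bopD bopN Tm subr0.
apply: le_trans (hC _) _; move: le; rewrite ler_pdivlMr //.
have := hnorm_ge0 (x - m); lra.
Qed.

Lemma ker_proj M T : vna M -> M T -> 
  exists P, [/\ M P, sa P, P * P = P, T * P = 0 & 
    (forall S, T * S = 0 -> P * S = S) /\
    forall S, S * T = T * S -> adj S * T = T * adj S -> S * P = P * S].
Proof.
move=> vM MT; have [P [sP PP KP cP]] := proj_op (ker_subspace T) (@ker_closed T).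
have comm S : S * T = T * S -> adj S * T = T * adj S -> S * P = P * S.
  move=> c1 c2; apply: cP => x /= Tx; rewrite -bop_mulE.
    by rewrite -c1 bopE Tx bop0.
  by rewrite -c2 bopE Tx bop0.
exists P; split=> //.
- apply: (vna_bic vM) => S cS; apply: comm; first exact: cS.
  by apply: (centralizes_adj vM cS).
- by apply: bop_ext => x; rewrite !bopE; apply/(KP (P x)); rewrite -bop_mulE PP.
- split=> // S TS; apply: bop_ext => x; rewrite bopE; apply/KP.
  by rewrite /= -bop_mulE TS.
Qed.

(** Factors are prime: the space of the x with a Y x = 0 for all Y in M is
    invariant under M and under its commutant, so its projection is central,
    that is 0 or 1. If it is 0 then b = 0, if it is 1 then a = 0. *)
Lemma factor_prime M a b : factor M -> M a -> M b ->
  (forall Y, M Y -> a * Y * b = 0) -> a = 0 \/ b = 0.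
Proof.
move=> [vM cM] Ma Mb h.
pose K := [set x | forall Y, M Y -> a (Y x) = 0].
have sK : subspace K.
  split=> [Y _|c x y Kx Ky Y MY]; first by rewrite !bop0.
  by rewrite !bopP Kx // Ky // scaler0 addr0.
have cK : hclosed K.
  move=> x hx Y MY; apply: (@ker_closed (a * Y)) => e /hx[m Km le].
  by exists m => //; exact: Km.
have [P [sP PP KP cP]] := proj_op sK cK.
have MP : M P.
  apply: (vna_bic vM) => S cS.
  have inv S' : centralizes M S' -> forall x, K x -> K (S' x).
    move=> cS' x Kx Y MY; rewrite -!bop_mulE -cS' //; last exact: vnaM.
    by rewrite bop_mulE bop_mulE Kx // bop0.
  by apply: cP; apply: inv => //; exact: centralizes_adj.
have [c Pc] : scalar_op P.
  apply: cM => // U MU; symmetry.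
  have inv U' : M U' -> forall x, K x -> K (U' x).
    by move=> MU' x Kx Y MY; rewrite -(bop_mulE Y); apply: Kx; exact: vnaM.
  by apply: cP; apply: inv => //; exact: vna_adj.
have [b0|/eqP b0] := eqVneq b 0; first by right.
have [x bx] : exists x, b x != 0.
  apply: contrapT => nx; apply: b0; apply: bop_ext => x; apply/eqP/negPn/negP => bx.
  by apply: nx; exists x.
left; have Kb : K (b x) by move=> Y MY; rewrite -!bop_mulE h.
have c1 : c = 1.
  have := (KP (b x)).1 Kb; rewrite Pc !bopE => /eqP; rewrite -subr_eq0.
  rewrite -{2}[b x]scale1r -scalerBl scaler_eq0 (negbTE bx) orbF subr_eq0 => /eqP //.
apply: bop_ext => y; have : K y by apply/KP; rewrite Pc c1 scale1r.
by move=> /(_ 1 (vna1 vM)).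
Qed.

Lemma pos_limit T : sa T -> (forall e, 0 < e -> pos (T + scal H e)) -> pos T.
Proof.
move=> sT h; apply/posP; split=> // x; have k0 : 0 < rip x x + 1 by have := rip_ge0 x; lra.
apply/ler_addgt0Pl => e e0; have := pos_rip x (h _ (divr_gt0 e0 k0)).
rewrite !bopE !ripE => h1; apply: le_trans h1 _; rewrite addrC lerD2r.
by rewrite mulrAC ler_pdivrMr // ler_wpM2l ?ltW //; lra.
Qed.

(** Otherwise every real t lies below a or above a, and a is the real number
    sup {t | t <= a}. *)
Lemma sa_split a : sa a -> ~ scalar_op a ->
  exists t, ~ pos (a - scal H t) /\ ~ pos (scal H t - a).
Proof.
move=> sa_a ns; apply: contrapT => nex.
have dich t : pos (a - scal H t) \/ pos (scal H t - a).
  by apply: contrapT => /not_orP[h1 h2]; apply: nex; exists t.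
have [r r0 [h1 h2]] := sa_bounded sa_a.
have [x0 x0n] : exists x : H, x != 0.
  apply: contrapT => nx; apply: ns; exists 0; apply: bop_ext => x; rewrite scale0r !bopE.
  by apply/eqP/negPn/negP => ax; apply: nx; exists (a x).
have xp : 0 < rip x0 x0.
  by rewrite lt_def rip_ge0 andbT; apply: contra_neq x0n; exact: rip_eq0.
pose D := [set t | pos (a - scal H t)].
have hD : has_sup D.
  split; first by exists (- r); rewrite /D /= scalN opprK addrC.
  exists (rip (a x0) x0 / rip x0 x0) => t /(pos_rip x0).
  by rewrite !bopE !ripE subr_ge0 ler_pdivlMr.
pose t0 := sup D.
have aE : a = scal H t0; last by apply: ns; exists t0%:C.
apply: ble_antisym.
  apply: pos_limit => [|e e0]; first by apply: saB => //; exact: sa_scal.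
  have [t Dt lt] := sup_adherent e0 hD.
  have -> : a - scal H t0 + scal H e = (a - scal H t) + scal H (t - (t0 - e)).
    by rewrite !scalD !scalN scalD scalN; op_ring.
  by apply: posD => //; apply: pos_scal; rewrite subr_ge0 ltW.
apply: pos_limit => [|e e0]; first by apply: saB => //; exact: sa_scal.
rewrite addrAC -scalD; case: (dich (t0 + e)) => // De.
have : t0 + e <= t0 by apply: ub_le_sup => //; case: hD.
lra.
Qed.

Lemma sa_parts T : exists a b, [/\ sa a, sa b, T = a + 'i *: b &
  forall M, vna M -> M T -> M a /\ M b].
Proof.
exists ((2^-1)%:C *: (T + adj T)), (((2^-1)%:C * - 'i) *: (T - adj T)).
have ci : conjc ((2^-1)%:C * - 'i) = - ((2^-1)%:C * - 'i) :> R[i].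
  by apply/eqP; rewrite eq_complex /=; apply/andP; split; apply/eqP; ring.
have h : ((2^-1)%:C + (2^-1)%:C = 1 :> R[i]).
  by rewrite -rmorphD /=; congr (_%:C); field.
split.
- by apply: saZ; rewrite /sa adjD adjK addrC.
- by rewrite /sa adjZ ci adjD adjN adjK scaleNr -scalerN opprB.
- rewrite scalerA mulrCA mulrN -expr2 sqr_i opprK mulr1 -scalerDr.
  have -> : T + adj T + (T - adj T) = T + T by op_ring.
  by rewrite scalerDr -scalerDl h scale1r.
- move=> M vM MT; have Ma := vna_adj vM MT.
  by split; apply: vnaZ => //; [exact: vnaD | exact: vnaB].
Qed.

End Algebras.

(** * A nonscalar factor contains projections P, Q with P Q P = P / 2 *)

Section HalfProjections.
Context (R : realType) (H : hilbertType R).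
Implicit Types (x y z : H) (S T U V P Q a b : bop H) (r s t : R) (M : set (bop H)).

(** Up to a factor 2, [absop a + a] and [absop a - a] are the positive and the
    negative part of a. *)
Definition absop a : bop H := bsqrt (a * a).
Lemma absop_comm a S : sa a -> S * a = a * S -> S * absop a = absop a * S.
Proof.
move=> sa_a c; apply: bsqrt_comm; first exact: pos_sq.
by rewrite mulrA c -mulrA c mulrA.
Qed.
Lemma absop_sub_add a : sa a -> (absop a - a) * (absop a + a) = 0.
Proof.
move=> sa_a; have c := absop_comm sa_a (erefl (a * a)).
by rewrite mulrBl !mulrDr c (bsqrtK (pos_sq sa_a)); op_ring.
Qed.
Lemma absop_sa a : sa a -> sa (absop a).
Proof. by move=> s; apply: bsqrt_sa; exact: pos_sq. Qed.
Lemma absop_pos a : sa a -> pos (absop a).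
Proof. by move=> s; apply: bsqrt_pos; exact: pos_sq. Qed.
Lemma absopN a : sa a -> absop a + a = 0 -> pos (- a).
Proof. by move=> s /eqP; rewrite addr_eq0 => /eqP <-; exact: absop_pos. Qed.
Lemma absop_eq a : sa a -> absop a - a = 0 -> pos a.
Proof. by move=> s /eqP; rewrite subr_eq0 => /eqP <-; exact: absop_pos. Qed.

(** For t as in [sa_split] the positive part p and the negative part n of a - t
    are nonzero and n p = 0. By primeness p Y n <> 0 for some Y, and the square
    of p Y n is 0. *)
Lemma square_zero_exists M T : factor M -> M T -> ~ scalar_op T ->
  exists Z, [/\ M Z, Z <> 0 & Z * Z = 0].
Proof.
move=> fM MT nT; have vM := factor_vna fM.
have [a [Ma sa_a na]] : exists a, [/\ M a, sa a & ~ scalar_op a].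
  have [a [b [sa_a sa_b TE hM]]] := sa_parts T; have [Ma Mb] := hM M vM MT.
  have [[c ac]|na] := pselect (scalar_op a); last by exists a.
  have [[d bd]|nb] := pselect (scalar_op b); last by exists b.
  by case: nT; exists (c + 'i * d); rewrite TE ac bd scalerA -scalerDl.
have [t [nt1 nt2]] := sa_split sa_a na.
set c := a - scal H t in nt1; have sc : sa c by apply: saB => //; exact: sa_scal.
have Mc : M c by apply: vnaB => //; exact: vna_scal.
have Mac : M (absop c) by apply: vna_sqrt => //; [exact: vnaM | exact: pos_sq].
have n1 : absop c + c <> 0.
  by move/(absopN sc); rewrite /c opprB.
have n2 : absop c - c <> 0 by move/(absop_eq sc).
have [Y MY nY] : exists2 Y, M Y & (absop c + c) * Y * (absop c - c) <> 0.
  apply: contrapT => nex; have [||Y MY|//|//] := @factor_prime _ _ M (absop c + c) (absop c - c) fM.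
  - exact: vnaD.
  - exact: vnaB.
  - by apply: contrapT => nY; apply: nex; exists Y.
exists ((absop c + c) * Y * (absop c - c)); split=> //.
  by apply: (vnaM vM); [apply: (vnaM vM) => //; exact: vnaD | exact: vnaB].
by rewrite -!mulrA (mulrA (absop c - c) (absop c + c)) absop_sub_add // mul0r !mulr0.
Qed.

(** P projects onto the kernel of the negative part of K - e; it contains the
    range of the positive part, which is nonzero for e small. *)
Lemma spectral_cut M K : vna M -> M K -> sa K -> ~ pos (- K) ->
  exists P (e : R), [/\ 0 < e, M P, sa P & P * P = P] /\
    [/\ P <> 0, K * P = P * K & pos ((K - scal H e) * P)].
Proof.
move=> vM MK sK nK.
have [e e0 ne] : exists2 e, 0 < e & ~ pos (scal H e - K).
  apply: contrapT => nex; apply: nK; apply: pos_limit => [|e e0]; first exact: saN.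
  by rewrite addrC; apply: contrapT => ne; apply: nex; exists e.
set d := K - scal H e; have sd : sa d by apply: saB => //; exact: sa_scal.
have Md : M d by apply: vnaB => //; exact: vna_scal.
have Mad : M (absop d) by apply: vna_sqrt => //; [exact: vnaM | exact: pos_sq].
have [P [MP sP PP NP [PN comm]]] := ker_proj vM (vnaB vM Mad Md).
have cadd : absop d * d = d * absop d by symmetry; exact: absop_comm.
have cKd : K * d = d * K by rewrite /d mulrBl mulrBr scal_comm.
have cKa : K * absop d = absop d * K by exact: absop_comm.
have cKP : K * P = P * K.
  by apply: comm; rewrite ?sK mulrBr mulrBl cKd cKa.
have caP : absop d * P = P * absop d.
  by apply: comm; rewrite ?(absop_sa sd) mulrBr mulrBl cadd.
exists P, e; split=> //; split=> //.
  move=> P0; apply: ne; have := PN _ (absop_sub_add sd); rewrite P0 mul0r => /esym/(absopN sd).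
  by rewrite opprB.
have -> : d * P = P * absop d * P.
  move/eqP: NP; rewrite mulrBl subr_eq0 => /eqP <-.
  by rewrite -caP -mulrA PP.
by apply: pos_sconj => //; exact: absop_pos.
Qed.

(** Polar decomposition of a square-zero Z, after cutting the spectrum of Z^* Z
    away from 0 by P, so that Z^* Z is invertible on the range of P and
    V = Z (Z^* Z)^(-1/2) P makes sense. *)
Lemma partial_isometry_exists M T : factor M -> M T -> ~ scalar_op T ->
  exists P V, [/\ M P, sa P, P * P = P & P <> 0] /\
    [/\ M V, adj V * V = P, V * V = 0, P * V = 0 & V * P = V].
Proof.
move=> fM MT nT; have vM := factor_vna fM.
have [Z [MZ Zn ZZ]] := square_zero_exists fM MT nT.
set K := adj Z * Z; have pK : pos K by exact: pos_adjM.
have sK := pos_sa pK; have MK : M K by apply: (vnaM vM) => //; exact: (vna_adj vM).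
have nK : ~ pos (- K).
  by move=> nK; apply: Zn; apply: adjM_eq0; exact: pos_antisym.
have [P [e [[e0 MP sP PP] [Pn cKP pKP]]]] := spectral_cut vM MK sK nK.
(* L is K on the range of P and e on its complement, hence invertible *)
pose L := (K - scal H e) * P + scal H e.
have pLe : pos (L - scal H e) by rewrite /L addrK.
have pL : pos L by rewrite -[L](subrK (scal H e)); apply: posD => //; apply: pos_scal; exact: ltW.
have sL := pos_sa pL.
have [G [GL LG]] := inverse_exists e0 sL pLe.
have ML : M L.
  by apply: (vnaD vM); [apply: (vnaM vM) => //; apply: (vnaB vM)|]; rewrite //; exact: (vna_scal vM).
have MG : M G by exact: (vna_inv vM ML).
have pG : pos G by exact: inverse_pos GL LG.
set g := bsqrt G; have Mg : M g by exact: (vna_sqrt vM).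
have sg : sa g by exact: bsqrt_sa.
have gg : g * g = G by exact: bsqrtK.
have cPd : P * (K - scal H e) = (K - scal H e) * P by rewrite mulrBl mulrBr cKP scal_comm.
have cPL : P * L = L * P.
  rewrite /L; move: (K - scal H e) cPd => d cPd.
  by rewrite mulrDr mulrDl mulrA cPd -scal_comm.
have LP : L * P = K * P.
  by rewrite /L (mulrDl ((K - scal H e) * P)) -mulrA PP mulrBl subrK.
have cPG : P * G = G * P by exact: inverse_comm GL LG cPL.
have cPg : P * g = g * P by exact: bsqrt_comm.
have cLg : L * g = g * L by apply: bsqrt_comm => //; rewrite LG GL.
have PZ : P * Z = 0.
  have -> : P = G * P * K by rewrite -mulrA -cKP -LP mulrA GL mul1r.
  by rewrite /K -!mulrA ZZ !mulr0.
pose V := Z * P * g.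
have aV : adj V = g * P * adj Z by rewrite /V !adjM sg sP mulrA.
exists P, V; split; first by [].
split.
- by apply: (vnaM vM) => //; apply: (vnaM vM).
- have -> : adj V * V = g * P * K * P * g by rewrite aV /V /K !mulrA.
  rewrite -[g * P * K * P]mulrA -LP -cPL mulrA -[g * P * P]mulrA PP -cPg.
  by rewrite -!mulrA cLg (mulrA g g) gg GL mulr1.
- by rewrite /V -(mulrA Z P g) cPg -!mulrA (mulrA P Z) PZ !(mul0r, mulr0).
- by rewrite /V !mulrA PZ !mul0r.
- by rewrite /V -mulrA -cPg -mulrA (mulrA P P) PP mulrA.
Qed.

(** The projection onto the graph of the partial isometry V, seen from its
    initial space P, has the flat corner P / 2. *)
Lemma half_projections M T : factor M -> M T -> ~ scalar_op T ->
  exists P Q, [/\ M P, sa P, P * P = P & P <> 0] /\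
    [/\ M Q, sa Q, Q * Q = Q & P * Q * P = (2^-1)%:C *: P].
Proof.
move=> fM MT nT; have vM := factor_vna fM.
have [P [V [[MP sP PP Pn] [MV VV' VV PV VP]]]] := partial_isometry_exists fM MT nT.
set V' := adj V in VV'; have MV' : M V' by exact: (vna_adj vM).
have V'P : V' * P = 0 by rewrite -sP -adjM PV adj0.
have PV' : P * V' = V' by rewrite -[in LHS]sP -adjM VP.
have V'V' : V' * V' = 0 by rewrite -adjM VV adj0.
pose X := P + V * V' + V + V'.
have XX : X * X = X + X.
  have e1 : V * V' * P = 0 by rewrite -mulrA V'P mulr0.
  have e2 : V * V' * V = V by rewrite -mulrA VV' VP.
  have e3 : V * V' * V' = 0 by rewrite -mulrA V'V' mulr0.
  rewrite /X !mulrDl !mulrDr !mulrA.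
  rewrite !(PP, PV, PV', VP, VV, V'P, VV', V'V', e1, e2, e3, mul0r, PV').
  by op_ring.
have hh : (2^-1)%:C * (2^-1)%:C + (2^-1)%:C * (2^-1)%:C = (2^-1)%:C :> R[i].
  by rewrite -rmorphM -rmorphD /=; congr (_%:C); field.
exists P, ((2^-1)%:C *: X); split=> //; split.
- by apply: (vnaZ vM); apply: (vnaD vM) => //; apply: (vnaD vM) => //; apply: (vnaD vM) => //; exact: (vnaM vM).
- by apply: saZ; rewrite /sa /X !adjD adjM sP -/V' adjK addrAC.
- by rewrite -bscaleAl -bscaleAr XX scalerA scalerDr -scalerDl hh.
- rewrite -bscaleAr -bscaleAl; congr (_ *: _).
  by rewrite /X !mulrDr !mulrDl !mulrA PP PV PV' V'P !mul0r !addr0 PP.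
Qed.
End HalfProjections.

(** * Effects and sequential isomorphisms *)

Section Effects.
Context (R : realType) (H : hilbertType R).
Implicit Types (S T U P Q a b : bop H) (r s t e : R) (M : set (bop H)).

Definition eff M T := [/\ M T, pos T & pos (1 - T)].
Definition sprod S T : bop H := bsqrt S * T * bsqrt S.

Lemma sprod_comm S T : pos S -> S * T = T * S -> sprod S T = S * T.
Proof.
by move=> pS c; rewrite /sprod -bsqrt_comm // -mulrA bsqrtK.
Qed.

Lemma sprod1 S : pos S -> sprod S 1 = S.
Proof. by move=> pS; rewrite /sprod mulr1 bsqrtK. Qed.

Lemma sprodD S T U : sprod S (T + U) = sprod S T + sprod S U.
Proof. by rewrite /sprod mulrDr mulrDl. Qed.

Lemma bsqrt_proj P : sa P -> P * P = P -> bsqrt P = P.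
Proof. by move=> sP PP; apply: bsqrt_uniq => //; rewrite -PP; exact: pos_sq. Qed.
Lemma pos_proj P : sa P -> P * P = P -> pos P.
Proof. by move=> sP <-; exact: pos_sq. Qed.
Lemma proj_compl P : P * P = P -> (1 - P) * (1 - P) = 1 - P.
Proof. by move=> PP; rewrite mulrBl mul1r mulrBr mulr1 PP subrr subr0. Qed.

Lemma pos_exp T n : pos T -> pos (T ^+ n).
Proof.
move=> pT; elim: n => [|n IH]; first by rewrite expr0; exact: pos1.
by rewrite exprS; apply: pos_commM => //; rewrite -exprS -exprSr.
Qed.
Lemma pos_sum I (r : seq I) (F : I -> bop H) :
  (forall i, pos (F i)) -> pos (\sum_(i <- r) F i).
Proof. by move=> h; elim/big_ind: _ => [|S T|i _] //; [exact: pos0 | exact: posD]. Qed.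
Lemma pos_natmul T n : pos T -> pos (T *+ n).
Proof. by move=> pT; elim: n => [|n IH]; rewrite ?mulr0n ?mulrS; [exact: pos0 | exact: posD]. Qed.

Lemma affine_compl r a : r != 0 ->
  1 - ((2 * r)^-1)%:C *: (scal H r + a) = ((2 * r)^-1)%:C *: (scal H r - a).
Proof.
move=> r0; have e : 1 = ((2 * r)^-1)%:C *: (scal H r + scal H r) :> bop H.
  rewrite -scalD /scal scalerA -rmorphM (_ : _ * _ = 1) ?scale1r //.
  by field.
by rewrite {1}e -scalerBr; congr (_ *: _); op_ring.
Qed.

Section Algebra.
Variable M : set (bop H).
Hypothesis vM : vna M.

Lemma eff_scal t : 0 <= t <= 1 -> eff M (scal H t).
Proof.
move=> /andP[t0 t1]; split; [exact: vna_scal | exact: pos_scal |].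
by rewrite -scal1 -scalN -scalD; apply: pos_scal; lra.
Qed.
Lemma eff0 : eff M 0.
Proof. by rewrite -(scal0 H); apply: eff_scal; rewrite lexx ler01. Qed.
Lemma eff1 : eff M 1.
Proof. by rewrite -(scal1 H); apply: eff_scal; rewrite lexx ler01. Qed.
Lemma eff_affine r a : 0 < r -> M a -> pos (scal H r + a) -> pos (scal H r - a) ->
  eff M (((2 * r)^-1)%:C *: (scal H r + a)).
Proof.
move=> r0 Ma p q; have k0 : 0 <= (2 * r)^-1 by rewrite invr_ge0; lra.
split; first by apply: vnaZ => //; apply: vnaD => //; exact: vna_scal.
  exact: posZ.
by rewrite affine_compl ?gt_eqF //; exact: posZ.
Qed.
Lemma eff_compl T : eff M T -> eff M (1 - T).
Proof.
move=> [MT p q]; split=> //; first by apply: vnaB => //; exact: (vna1 vM).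
by rewrite opprB addrC subrK.
Qed.
Lemma eff_sprod S T : eff M S -> eff M T -> eff M (sprod S T).
Proof.
move=> [MS pS qS] [MT pT qT]; have s := bsqrt_sa pS; split.
- by apply: (vnaM vM); [apply: (vnaM vM)|]; rewrite //; exact: vna_sqrt.
- exact: pos_sconj.
- have -> : 1 - sprod S T = (1 - S) + sprod S (1 - T).
    by rewrite /sprod mulrBr mulr1 mulrBl (bsqrtK pS) addrA subrK.
  by apply: posD => //; exact: pos_sconj.
Qed.
Lemma eff_mul S T : eff M S -> eff M T -> S * T = T * S -> eff M (S * T).
Proof.
by move=> eS eT c; rewrite -sprod_comm //; [exact: eff_sprod | case: eS].
Qed.
Lemma eff_scale t T : 0 <= t <= 1 -> eff M T -> eff M (t%:C *: T).
Proof.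
by move=> t01 eT; rewrite -scalMl; apply: eff_mul => //; [exact: eff_scal | exact: scal_comm].
Qed.
Lemma eff_exp T n : eff M T -> eff M (T ^+ n).
Proof.
move=> eT; elim: n => [|n IH]; first by rewrite expr0; exact: eff1.
by rewrite exprS; apply: eff_mul => //; rewrite -exprS -exprSr.
Qed.
Lemma eff_proj P : M P -> sa P -> P * P = P -> eff M P.
Proof.
move=> MP sP PP; split=> //; first exact: pos_proj.
by apply: pos_proj; [apply: saB => //; exact: sa1 | exact: proj_compl].
Qed.

(** The inverse square root of an invertible effect T conjugates the effects
    below T onto all effects. *)
Lemma inv_sqrt_exists T e : 0 < e -> eff M T -> pos (T - scal H e) ->
  exists g, [/\ M g, sa g, g * T * g = 1, bsqrt T * g = 1 & g * bsqrt T = 1] /\ pos (g * g - 1).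
Proof.
move=> e0 [MT pT qT] pe; have [G [GT TG]] := inverse_exists e0 (pos_sa pT) pe.
have pG := inverse_pos pT GT TG; have MG := vna_inv vM MT GT TG.
have sg := bsqrt_sa pG; have gg := bsqrtK pG.
have cTg : T * bsqrt G = bsqrt G * T by apply: bsqrt_comm => //; rewrite GT TG.
have cg : bsqrt G * bsqrt T = bsqrt T * bsqrt G by apply: bsqrt_comm.
have tg : bsqrt T * bsqrt G = 1.
  rewrite -[LHS]bsqrt_sq; last by apply: pos_commM => //; exact: bsqrt_pos.
  rewrite -[RHS]bsqrt_sq; last exact: pos1.
  rewrite mulr1 -mulrA (mulrA (bsqrt G)) cg -mulrA gg mulrA (bsqrtK pT) TG //.
exists (bsqrt G); split; first split=> //.
- exact: vna_sqrt.
- by rewrite -cTg -mulrA gg TG.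
- by rewrite cg.
- have -> : bsqrt G * bsqrt G - 1 = bsqrt G * (1 - T) * bsqrt G.
    by rewrite mulrBr mulr1 mulrBl -[bsqrt G * T]cTg -mulrA gg TG.
  exact: pos_sconj.
Qed.
End Algebra.
End Effects.

(** The inverse g is carried along because most arguments apply a result to f and
    then to g. *)
Record seqiso (R : realType) (H K : hilbertType R) (M : set (bop H)) (N : set (bop K))
    (f : bop H -> bop K) (g : bop K -> bop H) : Prop := SeqIso {
  si_factM : factor M ;
  si_factN : factor N ;
  si_nM : exists2 T, M T & ~ scalar_op T ;
  si_nN : exists2 T, N T & ~ scalar_op T ;
  si_eff : forall T, eff M T -> eff N (f T) ;
  si_eff' : forall T, eff N T -> eff M (g T) ;
  si_K : forall T, eff M T -> g (f T) = T ;
  si_K' : forall T, eff N T -> f (g T) = T ;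
  si_mul : forall S T, eff M S -> eff M T -> f (sprod S T) = sprod (f S) (f T) }.

Lemma seqiso_sym (R : realType) (H K : hilbertType R) (M : set (bop H)) (N : set (bop K)) f g :
  seqiso M N f g -> seqiso N M g f.
Proof.
move=> [fM fN nM nN ef eg k k' mul]; split=> // S T eS eT.
rewrite -{1}(k' S) // -{1}(k' T) // -mul ?k //; try exact: eg.
by apply: eff_sprod; [exact: factor_vna | exact: eg | exact: eg].
Qed.

Section SeqIsoBasic.
Context (R : realType) (H K : hilbertType R) (M : set (bop H)) (N : set (bop K)).
Variables (f : bop H -> bop K) (g : bop K -> bop H).
Hypothesis si : seqiso M N f g.
Implicit Types (S T : bop H) (t s e : R).
Let vM : vna M := factor_vna (si_factM si).
Let vN : vna N := factor_vna (si_factN si).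

Lemma si_inj S T : eff M S -> eff M T -> f S = f T -> S = T.
Proof. by move=> eS eT e; rewrite -(si_K si eS) e (si_K si eT). Qed.

Lemma si0 : f 0 = 0.
Proof.
have e0 := eff0 vN; have eg := si_eff' si e0.
have e1 : f (sprod 0 (g 0)) = 0.
  have -> : sprod 0 (g 0) = sprod (g 0) 0.
    have -> : sprod (0 : bop H) (g 0) = 0.
      rewrite sprod_comm ?mul0r ?mulr0 //; exact: pos0.
    by rewrite /sprod mulr0 mul0r.
  by rewrite (si_mul si) ?(si_K' si) //; [rewrite sprod_comm ?mul0r ?mulr0 //; exact: pos0 | exact: eff0].
by rewrite sprod_comm ?mul0r ?mulr0 // in e1; exact: pos0.
Qed.

(** The images have sequential products that agree, so they commute by
    [seq_commute]. *)
Lemma si_comm S T : eff M S -> eff M T -> S * T = T * S ->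
  f S * f T = f T * f S /\ f (S * T) = f S * f T.
Proof.
move=> eS eT c; have [[_ pS _] [_ pT _]] := (eS, eT).
have [[_ pfS _] [_ pfT _]] := (si_eff si eS, si_eff si eT).
have e1 := si_mul si eS eT; have e2 := si_mul si eT eS.
have E : sprod (f S) (f T) = sprod (f T) (f S).
  by rewrite -e1 -e2 !sprod_comm // c.
have cf : f S * f T = f T * f S by exact: seq_commute.
by split=> //; rewrite -sprod_comm // e1 sprod_comm.
Qed.

Lemma si1 : f 1 = 1.
Proof.
have e1 := eff1 vN; have eg := si_eff' si e1; have eM := eff1 vM.
have [c m] := si_comm eM eg (esym (commr1 (g 1))).
by move: m; rewrite mul1r (si_K' si) // mulr1 => ->.
Qed.

Lemma si_exp T n : eff M T -> f (T ^+ n) = f T ^+ n.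
Proof.
move=> eT; elim: n => [|n IH]; first by rewrite !expr0 si1.
have c : T * T ^+ n = T ^+ n * T by rewrite -exprS -exprSr.
by rewrite !exprS -IH; have [_ ->] := si_comm eT (eff_exp vM n eT) c.
Qed.

(** Every element of the algebra is a linear combination of effects. *)
Lemma centralizes_eff (V : bop K) : (forall T : bop K, eff N T -> V * T = T * V) -> centralizes N V.
Proof.
move=> h U NU; have [a [b [sa_a sa_b UE /(_ N vN NU) [Na Nb]]]] := sa_parts U.
have main c : N c -> sa c -> V * c = c * V.
  move=> Nc sc; have [r r0 [p q]] := sa_bounded sc.
  have := h _ (eff_affine vN r0 Nc q p); rewrite -bscaleAl -bscaleAr => E.
  have k1 : ((2 * r)^-1)%:C != 0 :> R[i].
    by rewrite fmorph_eq0 invr_eq0 mulf_neq0 ?gt_eqF.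
  have := scalerI k1 E; rewrite mulrDl mulrDr scal_comm => /addrI //.
by rewrite UE mulrDl mulrDr -bscaleAl -bscaleAr !main.
Qed.

Lemma nontrivialN : exists x : K, x != 0.
Proof.
have [T _ nT] := si_nN si; apply: contrapT => nx; apply: nT; exists 0.
apply: bop_ext => x; rewrite scale0r !bopE; apply/eqP/negPn/negP => ax.
by apply: nx; exists (T x).
Qed.

Lemma scal_posE t : pos (scal K t) -> 0 <= t.
Proof.
have [x x0] := nontrivialN.
move=> /(pos_rip x); rewrite scalE !ripE pmulr_lge0 // lt_def rip_ge0 andbT.
by apply: contra_neq x0; exact: rip_eq0.
Qed.

(** Scalars commute with all effects, so their images are central. *)
Lemma si_scal_ex t : 0 <= t <= 1 -> exists2 s, 0 <= s <= 1 & f (scal H t) = scal K s.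
Proof.
move=> t01; have et := eff_scal vM t01; have [Nf pf qf] := si_eff si et.
have [c fc] : scalar_op (f (scal H t)).
  apply: (factor_center (si_factN si)) => //; apply: centralizes_eff => U eU.
  have eg := si_eff' si eU.
  by have [+ _] := si_comm et eg (scal_comm _ _); rewrite (si_K' si).
have [x x0] := nontrivialN.
have xp : 0 < rip x x by rewrite lt_def rip_ge0 andbT; apply: contra_neq x0; exact: rip_eq0.
have c0 : 0 <= c.
  have := pf x; rewrite fc !bopE innerZl inner_rip pmulr_lge0 //.
  by rewrite ltcR.
have cE : c = (complex.Re c)%:C by rewrite RRe_real // ger0_real.
have fE : f (scal H t) = scal K (complex.Re c) by rewrite fc /scal -cE.
exists (complex.Re c) => //; rewrite -ler0c -cE c0 /=.
move: qf; rewrite fE -scal1 -scalN -scalD => /scal_posE; lra.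
Qed.

Lemma scal_inj t s : scal K t = scal K s -> t = s.
Proof.
move=> e; have := scal_posE (t := t - s); have := scal_posE (t := s - t).
rewrite !scalD !scalN e subrr => /(_ (@pos0 _ _)) a /(_ (@pos0 _ _)) b; lra.
Qed.

Lemma si_scaleE t s T : 0 <= t <= 1 -> f (scal H t) = scal K s -> eff M T ->
  f (t%:C *: T) = s%:C *: f T.
Proof.
move=> t01 fE eT; rewrite -scalMl.
by have [_ ->] := si_comm (eff_scal vM t01) eT (scal_comm _ _); rewrite fE scalMl.
Qed.

Lemma si_proj P : M P -> sa P -> P * P = P -> [/\ N (f P), sa (f P) & f P * f P = f P].
Proof.
move=> MP sP PP; have eP := eff_proj MP sP PP; have [Nf pf _] := si_eff si eP.
split=> //; first exact: pos_sa.
by have [_ <-] := si_comm eP eP erefl; rewrite PP.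
Qed.

End SeqIsoBasic.

Section SeqIsoHalf.
Context (R : realType) (H K : hilbertType R) (M : set (bop H)) (N : set (bop K)).
Variables (f : bop H -> bop K) (g : bop K -> bop H).
Hypothesis si : seqiso M N f g.
Implicit Types (S T : bop H) (t s e : R).
Let vM : vna M := factor_vna (si_factM si).
Let vN : vna N := factor_vna (si_factN si).

(** f P and f (1 - P) are orthogonal projections; that 1 - f P is not larger than
    f (1 - P) is the same orthogonality for g. *)
Lemma si_proj_compl P : M P -> sa P -> P * P = P -> f (1 - P) = 1 - f P.
Proof.
move=> MP sP PP; have eP := eff_proj MP sP PP; have eC := eff_compl vM eP.
have [MC _ _] := eC; have sC := pos_sa (let: And3 _ p _ := eC in p).
have [Nf sf ff] := si_proj si MP sP PP.
have [NC sfC fCC] := si_proj si MC sC (proj_compl PP).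
have cP : P * (1 - P) = (1 - P) * P by rewrite mulrBl mulrBr mul1r mulr1.
have fP0 : f P * f (1 - P) = 0.
  by have [_ <-] := si_comm si eP eC cP; rewrite mulrBr mulr1 PP subrr (si0 si).
set Q := 1 - f P; have eQ : eff N Q by apply: eff_compl => //; exact: (si_eff si).
have [NQ _ _] := eQ; have sQ := pos_sa (let: And3 _ p _ := eQ in p).
have eg := si_eff' si eQ.
have sy := seqiso_sym si.
have cQ : f P * Q = Q * f P by rewrite /Q mulrBl mulrBr mul1r mulr1.
have [cg gP0] := si_comm sy (si_eff si eP) eQ cQ.
have gP : P * g Q = 0.
  by rewrite -{1}(si_K si eP) -gP0 /Q mulrBr mulr1 ff subrr (si0 sy).
have cCg : (1 - P) * g Q = g Q * (1 - P).
  by rewrite mulrBl mulrBr mul1r mulr1 -{1}(si_K si eP) cg (si_K si eP).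
have gCE : (1 - P) * g Q = g Q by rewrite mulrBl mul1r gP subr0.
have QE : Q = f (1 - P) * Q.
  by have [_] := si_comm si eC eg cCg; rewrite gCE (si_K' si).
have QE' : Q = Q * f (1 - P).
  by rewrite -[LHS]sQ {1}QE adjM sQ sfC.
by rewrite QE' /Q mulrBl mul1r fP0 subr0.
Qed.

(** Noncommutativity enters here: on a commutative algebra the power maps
    T |-> T^c are sequential isomorphisms. With P Q P = P / 2, both
    f (P Q P) and f (P (1 - Q) P) equal s f P where f (1/2) = s, and they add up
    to f P because f (1 - Q) = 1 - f Q. *)
Lemma si_half : f (scal H 2^-1) = scal K 2^-1.
Proof.
have h01 : 0 <= (2^-1 : R) <= 1 by apply/andP; split; lra.
have [s _ fs] := si_scal_ex si h01.
have [T MT nT] := si_nM si.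
have [P [Q [[MP sP PP Pn] [MQ sQ QQ PQP]]]] := half_projections (si_factM si) MT nT.
have eP := eff_proj MP sP PP; have eQ := eff_proj MQ sQ QQ.
have e1 : sprod P Q = (2^-1)%:C *: P by rewrite /sprod bsqrt_proj.
have hh : (2^-1)%:C + (2^-1)%:C = 1 :> R[i].
  by rewrite -rmorphD /=; congr (_%:C); field.
have e2 : sprod P (1 - Q) = (2^-1)%:C *: P.
  rewrite /sprod bsqrt_proj // mulrBr mulr1 mulrBl PP PQP.
  by rewrite -{1}[P]scale1r -hh scalerDl addrK.
have f1 := si_mul si eP eQ; have f2 := si_mul si eP (eff_compl vM eQ).
rewrite e1 (si_scaleE si h01 fs) // in f1; rewrite e2 (si_scaleE si h01 fs) // in f2.
have E : s%:C *: f P + s%:C *: f P = f P.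
  rewrite {1}f1 f2 si_proj_compl // -sprodD addrC subrK sprod1 //.
  by case: (si_eff si eP).
have fPn : f P != 0.
  apply/eqP => fP0; apply: Pn; apply: (si_inj si eP (eff0 vM)).
  by rewrite fP0 (si0 si).
have : (s + s - 1)%:C *: f P = 0.
  by rewrite rmorphB rmorphD scalerBl scalerDl E scale1r subrr.
move/eqP; rewrite scaler_eq0 (negbTE fPn) orbF fmorph_eq0 => /eqP s1.
by rewrite fs; congr scal; lra.
Qed.

Lemma si_scal_mono t t' s s' : 0 <= t -> t <= t' -> 0 < t' <= 1 ->
  f (scal H t) = scal K s -> f (scal H t') = scal K s' -> s <= s'.
Proof.
move=> t0 tt' /andP[t'0 t'1] fs fs'.
have q01 : 0 <= t / t' <= 1 by rewrite divr_ge0 ?(ltW t'0) //= ler_pdivrMr // mul1r.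
have t'01 : 0 <= t' <= 1 by rewrite t'1 andbT ltW.
have [q /andP[q0 q1] fq] := si_scal_ex si q01.
have [s2 /andP[s20 _]] := si_scal_ex si t'01; rewrite fs' => /(scal_inj si) s2E.
have : f (scal H t) = scal K (s' * q).
  have -> : t = t' * (t / t') by rewrite mulrC divfK // gt_eqF.
  rewrite (scalM _ t') (scalM _ s') -fs' -fq.
  by have [_ ->] := si_comm si (eff_scal vM t'01) (eff_scal vM q01) (scal_comm _ _).
by rewrite fs => /(scal_inj si) ->; apply: ler_piMr => //; rewrite s2E.
Qed.

Lemma scalX (L : hilbertType R) t n : scal L t ^+ n = scal L (t ^+ n).
Proof. by elim: n => [|n IH]; rewrite ?expr0 ?scal1 // !exprS scalM IH. Qed.

(** On scalars f is multiplicative, monotone and fixes the powers of 1/2. If s < t,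
    some power of 1/2 is larger than s^n and at most t^n for n large, against
    monotonicity. *)
Lemma si_scal_ge t s : 0 <= t <= 1 -> 0 <= s <= 1 -> f (scal H t) = scal K s -> t <= s.
Proof.
move=> t01 s01 fs; have [/andP[t0 t1] /andP[s0 s1]] := (t01, s01).
rewrite leNgt; apply/negP => st.
have tp : 0 < t by exact: le_lt_trans st.
have sp : 0 < s.
  rewrite lt_def s0 andbT; apply/eqP => sz; move: fs; rewrite sz scal0 -(si0 si) => e.
  have := si_inj si (eff_scal vM t01) (eff0 vM) e => e'.
  have /eqP : scal H t = scal H 0 by rewrite e' scal0.
  by move=> /eqP/(scal_inj (seqiso_sym si)) tz; rewrite tz ltxx in tp.
have [j jP] : exists j, 2 < (t / s) ^+ (2 ^ j).
  apply: contrapT => nj; suff : t / s <= 1 by rewrite ler_pdivrMr // mul1r leNgt st.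
  apply: (@pow2_growth _ _ 2); first by rewrite divr_ge0.
  move=> j; rewrite leNgt; apply/negP => lt; apply: nj; exists j.
  by apply: le_lt_trans lt; rewrite ler_peMr // ler1n.
set n := (2 ^ j)%N in jP.
have sn : 2 * s ^+ n < t ^+ n.
  by move: jP; rewrite expr_div_n ltr_pdivlMr // exprn_gt0.
have tn0 : 0 < t ^+ n by rewrite exprn_gt0.
have tn1 : t ^+ n <= 1 by apply: exprn_ile1.
have exk : exists k, 2^-1 ^+ k <= t ^+ n.
  have q0 : 0 <= (t ^+ n)^-1 by rewrite invr_ge0 ltW.
  exists (Num.bound (t ^+ n)^-1); have lt := archi_boundP q0.
  rewrite exprVn -[leRHS]invrK lef_pV2 ?posrE ?invr_gt0 ?exprn_gt0 //.
  apply: ltW; apply: lt_trans lt _; rewrite -natrX ltr_nat; exact: ltn_expl.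
have [k kP kmin] := ex_minnP exk.
have sk : s ^+ n < 2^-1 ^+ k.
  case: k kP kmin => [|k] kP kmin.
    by rewrite expr0; lra.
  have : ~~ (2^-1 ^+ k <= t ^+ n) by apply/negP => /kmin; rewrite ltnn.
  by rewrite -ltNge exprS; lra.
have h01 : 0 <= (2^-1 : R) <= 1 by apply/andP; split; lra.
have f1 : f (scal H (2^-1 ^+ k)) = scal K (2^-1 ^+ k).
  by rewrite -!scalX (si_exp si) ?si_half //; exact: eff_scal.
have f2 : f (scal H (t ^+ n)) = scal K (s ^+ n).
  by rewrite -!scalX (si_exp si) ?fs //; exact: eff_scal.
have : 2^-1 ^+ k <= s ^+ n.
  by apply: (si_scal_mono _ kP _ f1 f2); rewrite ?tn0 ?exprn_ge0.
by rewrite leNgt sk.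
Qed.
End SeqIsoHalf.

Section SeqIsoHomogeneous.
Context (R : realType) (H K : hilbertType R) (M : set (bop H)) (N : set (bop K)).
Variables (f : bop H -> bop K) (g : bop K -> bop H).
Hypothesis si : seqiso M N f g.
Implicit Types (S T : bop H) (t s e : R).
Let vM : vna M := factor_vna (si_factM si).
Let vN : vna N := factor_vna (si_factN si).

Lemma si_scal t : 0 <= t <= 1 -> f (scal H t) = scal K t.
Proof.
move=> t01; have [s s01 fs] := si_scal_ex si t01; rewrite fs; congr scal.
apply/eqP; rewrite eq_le (si_scal_ge si t01 s01 fs) andbT.
apply: (si_scal_ge (seqiso_sym si) s01 t01).
by rewrite -fs (si_K si) //; exact: eff_scal.
Qed.

Lemma si_scale t T : 0 <= t <= 1 -> eff M T -> f (t%:C *: T) = t%:C *: f T.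
Proof. by move=> t01 eT; exact: (si_scaleE si t01 (si_scal t01) eT). Qed.

(** Put X = f T and Y = f (1 - T), which commute. The terms c T^k (1 - T)^l of the
    binomial expansion of (T + (1 - T))^n = 1 are effects, and f maps them to the
    terms c X^k Y^l of the expansion of (X + Y)^n. So each of the n + 1 terms of
    the latter is at most 1. *)
Lemma si_sum_exp_le T n : eff M T -> pos (scal K n.+1%:R - (f T + f (1 - T)) ^+ n).
Proof.
move=> eT; have eC := eff_compl vM eT.
have cT : T * (1 - T) = (1 - T) * T by rewrite mulrBl mulrBr mul1r mulr1.
have [cf _] := si_comm si eT eC cT.
rewrite (exprDn_comm n (cf : GRing.comm _ _)).
have -> : scal K n.+1%:R = \sum_(i < n.+1) (1 : bop K).
  by rewrite sumr_const card_ord /scal rmorph_nat scaler_nat.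
rewrite -sumrB; apply: pos_sum => i.
set c := 'C(n, i); have c0 : (0 < c)%N by rewrite bin_gt0 -ltnS.
have cXX k l : T ^+ k * (1 - T) ^+ l = (1 - T) ^+ l * T ^+ k.
  by apply: commrX; apply: commr_sym; apply: commrX; exact: esym.
have eE k l : eff M (T ^+ k * (1 - T) ^+ l).
  by apply: eff_mul => //; exact: eff_exp.
have eCE : eff M ((T ^+ (n - i) * (1 - T) ^+ i) *+ c).
  have [ME pE _] := eE (n - i)%N i.
  split; first by rewrite -scaler_nat; exact: vnaZ.
    exact: pos_natmul.
  have e1 : 1 = (T + (1 - T)) ^+ n by rewrite addrC subrK expr1n.
  rewrite {1}e1 (exprDn_comm n (cT : GRing.comm _ _)) (bigD1 i) //= addrAC subrr add0r.
  rewrite big_mkcond; apply: pos_sum => j; case: ifP => _; last exact: pos0.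
  by apply: pos_natmul; case: (eE (n - j)%N j).
have [_ _] := si_eff si eCE; congr pos; congr (1 - _).
have ci : 0 <= ((c%:R)^-1 : R) <= 1.
  by rewrite invr_ge0 ler0n /= invf_le1 ?ltr0n // ler1n.
have cC : ((c%:R)^-1)%:C = (c%:R)^-1 :> R[i] by rewrite fmorphV rmorph_nat.
have EE : T ^+ (n - i) * (1 - T) ^+ i = ((c%:R)^-1)%:C *: ((T ^+ (n - i) * (1 - T) ^+ i) *+ c).
  by rewrite cC -[X in _ = _ *: X]scaler_nat scalerA mulVf ?scale1r // pnatr_eq0 -lt0n.
have [_ fE] := si_comm si (eff_exp vM (n - i) eT) (eff_exp vM i eC) (cXX _ _).
rewrite !(si_exp si) // in fE.
have := si_scale ci eCE; rewrite -EE fE => ->.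
by rewrite cC -[RHS]scaler_nat scalerA mulfV ?scale1r // pnatr_eq0 -lt0n.
Qed.

(** The n-th power of X + Y grows at most linearly in n by [si_sum_exp_le], hence
    X + Y has norm at most 1. *)
Lemma si_compl_le T : eff M T -> pos (1 - (f T + f (1 - T))).
Proof.
move=> eT; have eC := eff_compl vM eT.
have [_ p1 _] := si_eff si eT; have [_ p2 _] := si_eff si eC.
set X := f T + f (1 - T); have pX : pos X by exact: posD.
have sX := pos_sa pX.
rewrite -scal1; apply: bound_le => // x; rewrite mul1r.
have nX : normal X by rewrite /normal sX.
have [h0|h0] := eqVneq (hnorm x) 0; first by rewrite (hnorm_eq0 h0) bop0.
have hp : 0 < hnorm x by rewrite lt_def h0 hnorm_ge0.
rewrite -[leRHS]mul1r -ler_pdivrMr //; apply: (@pow2_growth _ _ 1).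
  by rewrite divr_ge0 ?hnorm_ge0.
move=> j; rewrite mul1r expr_div_n ler_pdivrMr ?exprn_gt0 // -(ler_pM2r hp).
apply: le_trans (normal_pow2_le j x nX) _; rewrite mulrAC ler_wpM2r ?exprn_ge0 ?hnorm_ge0 //.
by apply: pos_bound => //; [exact: pos_exp | exact: si_sum_exp_le].
Qed.

(** If S <= T and T is invertible, then S is the sequential product of T with an
    effect. *)
Lemma si_mono S T e : 0 < e -> eff M S -> eff M T -> pos (T - scal H e) -> pos (T - S) ->
  pos (f T - f S).
Proof.
move=> e0 eS eT pe pTS; have [[MS pS _] [MT pT _]] := (eS, eT).
have [h [[Mh sh hTh th ht] _]] := inv_sqrt_exists vM e0 eT pe.
have eC : eff M (h * S * h).
  split; first by apply: (vnaM vM) => //; exact: (vnaM vM).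
    exact: pos_sconj.
  have -> : 1 - h * S * h = h * (T - S) * h by rewrite mulrBr mulrBl hTh.
  exact: pos_sconj.
have SE : S = sprod T (h * S * h).
  by rewrite /sprod !mulrA th mul1r -mulrA ht mulr1.
have [Nf pf _] := si_eff si eT.
rewrite SE (si_mul si) // -{1}(sprod1 pf).
have -> : sprod (f T) 1 - sprod (f T) (f (h * S * h)) = sprod (f T) (1 - f (h * S * h)).
  by rewrite /sprod mulrBr mulrBl.
by apply: pos_sconj; [exact: bsqrt_sa | case: (si_eff si eC)].
Qed.
End SeqIsoHomogeneous.

Section SeqIsoAdditive.
Context (R : realType) (H K : hilbertType R) (M : set (bop H)) (N : set (bop K)).
Variables (f : bop H -> bop K) (g : bop K -> bop H).
Hypothesis si : seqiso M N f g.
Implicit Types (S T : bop H) (t s e : R).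
Let vM : vna M := factor_vna (si_factM si).
Let vN : vna N := factor_vna (si_factN si).

(** One inequality is [si_compl_le]. Applied to g and 1 - f T it yields
    g (1 - f T) <= 1 - T, and [si_mono] turns this into the other one. *)
Lemma si_compl T e : 0 < e -> eff M T -> pos (1 - T - scal H e) -> f T + f (1 - T) = 1.
Proof.
move=> e0 eT pe; apply: ble_antisym; last exact: (si_compl_le si).
have eX := si_eff si eT; have eX' := eff_compl vN eX.
have := si_compl_le (seqiso_sym si) eX; rewrite (si_K si eT) opprD addrA => p.
have := si_mono si e0 (si_eff' si eX') (eff_compl vM eT) pe p.
by rewrite (si_K' si eX') opprB addrCA addrA.
Qed.

(** S and T are the sequential products of S + T with two effects that add up to
    1, so this is [si_compl] multiplied by f (S + T). *)
Lemma si_add_inv S T e : 0 < e -> eff M S -> eff M T -> eff M (S + T) ->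
  pos (T - scal H e) -> f (S + T) = f S + f T.
Proof.
move=> e0 eS eT eST pe; have [[MS pS _] [MT pT _]] := (eS, eT).
have pe' : pos (S + T - scal H e) by rewrite -addrA; exact: posD.
have [h [[Mh sh hh th ht] hp]] := inv_sqrt_exists vM e0 eST pe'.
have hE : 1 - h * S * h = h * T * h.
  by rewrite -hh mulrDr mulrDl addrC addKr.
have eC : eff M (h * S * h).
  split; first by apply: (vnaM vM) => //; exact: (vnaM vM).
    exact: pos_sconj.
  by rewrite hE; exact: pos_sconj.
have back U : sprod (S + T) (h * U * h) = U.
  by rewrite /sprod !mulrA th mul1r -mulrA ht mulr1.
have pC : pos (1 - h * S * h - scal H e).
  have -> : 1 - h * S * h - scal H e = h * (T - scal H e) * h + e%:C *: (h * h - 1).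
    by rewrite hE mulrBr mulrBl scalMr -bscaleAl scalerBr /scal addrA subrK.
  by apply: posD; [exact: pos_sconj | apply: posZ => //; exact: ltW].
have := si_compl e0 eC pC; rewrite hE => E.
have eD : eff M (h * T * h) by rewrite -hE; exact: eff_compl.
have -> : f S = sprod (f (S + T)) (f (h * S * h)) by rewrite -(si_mul si) // back.
have -> : f T = sprod (f (S + T)) (f (h * T * h)) by rewrite -(si_mul si) // back.
by rewrite -sprodD E sprod1 //; case: (si_eff si eST).
Qed.

(** Homogeneity leaves room to shift by a scalar, which makes [si_add_inv]
    applicable and can be cancelled afterwards. *)
Theorem si_add S T : eff M S -> eff M T -> eff M (S + T) -> f (S + T) = f S + f T.
Proof.
move=> eS eT eST.
have q01 : 0 <= (4^-1 : R) <= 1 by apply/andP; split; lra.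
have qp : 0 < 4^-1 :> R by lra.
have qC : (4^-1)%:C != 0 :> R[i] by rewrite fmorph_eq0 invr_eq0 pnatr_eq0.
set k := (4^-1)%:C in qC.
apply: (scalerI qC); rewrite scalerDr -!(si_scale si q01) // scalerDr -/k.
set A := k *: S; set B := k *: T; set E := scal H 4^-1.
have eA : eff M A by exact: eff_scale.
have eB : eff M B by exact: eff_scale.
have eAB : eff M (A + B) by rewrite -scalerDr; exact: eff_scale.
have eE : eff M E by exact: eff_scal.
have le U : eff M U -> pos (E - k *: U).
  move=> [_ _ p]; rewrite /E /scal -scalerBr; apply: posZ => //; exact: ltW.
have MD := vnaD vM; have pE0 : pos (E - E) by rewrite subrr; exact: pos0.
have sum3 : pos (1 - (A + B + E)).
  have -> : 1 - (A + B + E) = (E - k *: (S + T)) + scal H (2^-1).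
    have one : 1 = E + E + scal H 2^-1 by rewrite -!scalD -[LHS]scal1; congr scal; field.
    have gen (X Y Z : bop H) : X + X + Y - (Z + X) = X - Z + Y by op_ring.
    by rewrite scalerDr -/A -/B {1}one gen.
  by apply: posD; [exact: le | apply: pos_scal; lra].
have [[MA pA _] [MB pB _] [ME pE _] [MAB pAB _]] := (And4 eA eB eE eAB).
have eABE : eff M (A + B + E).
  by split=> //; [apply: MD | apply: posD].
have eBE : eff M (B + E).
  split; [exact: MD | exact: posD |].
  have -> : 1 - (B + E) = 1 - (A + B + E) + A by op_ring.
  exact: posD.
have h1 : f (A + B + E) = f (A + B) + f E by apply: (si_add_inv qp).
have h2 : f (B + E) = f B + f E by apply: (si_add_inv qp).
have h3 : f (A + (B + E)) = f A + f (B + E).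
  apply: (si_add_inv qp) => //; first by rewrite addrA.
  by rewrite -addrA; apply: posD.
by apply: (addIr (f E)); rewrite -h1 -addrA h3 h2 addrA.
Qed.
End SeqIsoAdditive.

(** * Jordan homomorphisms onto a prime algebra *)

Section Herstein.
Context (R : realType) (H K : hilbertType R).
Variables (M : set (bop H)) (N : set (bop K)) (psi : bop H -> bop K).
Hypotheses (MD : forall S T, M S -> M T -> M (S + T))
  (MM : forall S T, M S -> M T -> M (S * T))
  (ND : forall S T, N S -> N T -> N (S + T))
  (NN : forall S, N S -> N (- S))
  (NM : forall S T, N S -> N T -> N (S * T))
  (Nprime : forall a b, N a -> N b -> (forall Y, N Y -> a * Y * b = 0) -> a = 0 \/ b = 0)
  (psiN : forall T, M T -> N (psi T))
  (psi_surj : forall U, N U -> exists2 T, M T & psi T = U)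
  (psiD : forall S T, M S -> M T -> psi (S + T) = psi S + psi T)
  (psi_sq : forall T, M T -> psi (T * T) = psi T * psi T).

Lemma double_inj (L : hilbertType R) (S T : bop L) : S + S = T + T -> S = T.
Proof.
move=> e; apply: (@scalerI R[i] _ 2%:R); first by rewrite pnatr_eq0.
by rewrite !scaler_nat !mulr2n.
Qed.

Lemma jordan2 S T : M S -> M T -> psi (S * T + T * S) = psi S * psi T + psi T * psi S.
Proof.
move=> MS MT; have := psi_sq (MD MS MT).
have e : (S + T) * (S + T) = S * S + (S * T + T * S) + T * T.
  by rewrite mulrDl !mulrDr; op_ring.
have [m1 m2 m3] : [/\ M (S * S), M (S * T + T * S) & M (T * T)].
  by split; [apply: MM | apply: MD; apply: MM | apply: MM].
rewrite e (psiD (MD m1 m2) m3) (psiD m1 m2) (psiD MS MT).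
rewrite !psi_sq // mulrDl !mulrDr => E.
apply: (addrI (psi S * psi S)); apply: (addIr (psi T * psi T)).
by rewrite E; op_ring.
Qed.

Lemma jordan3 S T : M S -> M T -> psi (S * T * S) = psi S * psi T * psi S.
Proof.
move=> MS MT; have MST := MM MS MT; have MTS := MM MT MS.
have MA := MD MST MTS; have MSS := MM MS MS; have MSTS := MM MST MS.
have e : S * (S * T + T * S) + (S * T + T * S) * S =
    S * T * S + S * T * S + (S * S * T + T * (S * S)).
  by rewrite !mulrDr !mulrDl; op_ring.
have E := jordan2 MS MA.
rewrite e (psiD (MD MSTS MSTS) (MD (MM MSS MT) (MM MT MSS))) (psiD MSTS MSTS) in E.
rewrite (jordan2 MSS MT) (jordan2 MS MT) psi_sq // in E; apply: double_inj.
apply: (addIr (psi S * psi S * psi T + psi T * (psi S * psi S))).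
by rewrite E !mulrDr !mulrDl; op_ring.
Qed.

Lemma jordan_triple S T U : M S -> M T -> M U ->
  psi (S * T * U + U * T * S) = psi S * psi T * psi U + psi U * psi T * psi S.
Proof.
move=> MS MT MU; have := jordan3 (MD MS MU) MT.
have e : (S + U) * T * (S + U) = S * T * S + (S * T * U + U * T * S) + U * T * U.
  by rewrite !mulrDl !mulrDr; op_ring.
have m X Y Z : M X -> M Y -> M Z -> M (X * Y * Z) by move=> *; apply: (MM (MM _ _)).
have [m1 m2 m3] : [/\ M (S * T * S), M (S * T * U + U * T * S) & M (U * T * U)].
  by split; [exact: m | apply: MD; exact: m | exact: m].
rewrite e (psiD (MD m1 m2) m3) (psiD m1 m2) (psiD MS MU).
rewrite !jordan3 // !mulrDl !mulrDr => E.
apply: (addrI (psi S * psi T * psi S)); apply: (addIr (psi U * psi T * psi U)).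
by rewrite E; op_ring.
Qed.

(** With w = a X b, moving the factors across one another in two ways shows
    w Y w = - w Y w for all Y, so w = 0 by primeness, for all X. *)
Lemma prime_alternating a b : N a -> N b -> (forall Y, N Y -> a * Y * b = - (b * Y * a)) ->
  a = 0 \/ b = 0.
Proof.
move=> Na Nb h; apply: Nprime => // X NX.
have Nw : N (a * X * b) by apply: NM => //; exact: NM.
suff /(Nprime Nw Nw)[] : forall Y, N Y -> a * X * b * Y * (a * X * b) = 0 by [].
move=> Y NY; apply: double_inj; rewrite addr0; apply/eqP; rewrite addr_eq0; apply/eqP.
have e1 : b * Y * a = - (a * Y * b) by rewrite h // opprK.
have NZ : N (X * a * Y) by apply: NM => //; exact: NM.
have e2 := h _ NZ; have e3 : b * X * a = - (a * X * b) by rewrite h // opprK.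
transitivity (a * X * (b * Y * a) * X * b); first by rewrite !mulrA.
rewrite e1 mulrN !mulNr; congr (- _).
transitivity (a * (X * a * Y) * b * X * b); first by rewrite !mulrA.
rewrite e2 !mulNr.
transitivity (- (b * X * a * Y * (a * X * b))); first by rewrite !mulrA.
by rewrite e3 !mulNr opprK.
Qed.

(** The image of S T X T S + T S X S T can be computed from the Jordan triple of
    S T, X, T S and from S (T X T) S and T (S X S) T. Comparison shows that the
    defects a = psi (S T) - psi S psi T and b = psi (S T) - psi T psi S satisfy
    a Y b = - b Y a for all Y, which is the case of [prime_alternating]. *)
Lemma mul_or_antimul S T : M S -> M T ->
  psi (S * T) = psi S * psi T \/ psi (S * T) = psi T * psi S.
Proof.
move=> MS MT; have MST := MM MS MT; have MTS := MM MT MS.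
set u := psi (S * T); set p := psi S * psi T; set q := psi T * psi S.
have [Nu Np Nq] : [/\ N u, N p & N q] by split; [exact: psiN | apply: NM | apply: NM]; exact: psiN.
have uE : psi (T * S) = p + q - u.
  by apply: (addrI u); rewrite -psiD // jordan2 // addrCA subrr addr0.
have key : forall Y, N Y -> (u - p) * Y * (u - q) = - ((u - q) * Y * (u - p)).
  move=> _ /psi_surj[X MX <-].
  have := jordan_triple MST MX MTS; rewrite uE -/u.
  have -> : S * T * X * (T * S) + T * S * X * (S * T) =
      S * (T * X * T) * S + T * (S * X * S) * T by rewrite !mulrA.
  have MTX : M (T * X * T) by apply: (MM (MM _ _)).
  have MSX : M (S * X * S) by apply: (MM (MM _ _)).
  rewrite psiD ?jordan3 //; try by apply: (MM (MM _ _)).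
  have -> : psi S * (psi T * psi X * psi T) * psi S = p * psi X * q by rewrite /p /q !mulrA.
  have -> : psi T * (psi S * psi X * psi S) * psi T = q * psi X * p by rewrite /p /q !mulrA.
  clearbody u p q; move: (psi X) => Y E.
  apply/eqP; rewrite -addr_eq0; apply/eqP.
  transitivity (p * Y * q + q * Y * p - (u * Y * (p + q - u) + (p + q - u) * Y * u)).
    by op_ring.
  by rewrite E subrr.
have Nup : N (u - p) by apply: ND => //; exact: NN.
have Nuq : N (u - q) by apply: ND => //; exact: NN.
by have [/eqP|/eqP] := prime_alternating Nup Nuq key; rewrite subr_eq0 => /eqP; [left|right].
Qed.

(** An additive group is not the union of two proper subgroups. *)
Lemma cover_alternative (P Q : bop H -> Prop) :
  (forall T, M T -> P T \/ Q T) ->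
  (forall S T, M S -> M T -> P (S + T) -> P T -> P S) ->
  (forall S T, M S -> M T -> Q (S + T) -> Q S -> Q T) ->
  (forall T, M T -> P T) \/ (forall T, M T -> Q T).
Proof.
move=> PQ hP hQ; apply: contrapT => /not_orP[/existsNP[S /not_implyP[MS nP]] /existsNP[T /not_implyP[MT nQ]]].
have QS : Q S by case: (PQ S MS).
have PT : P T by case: (PQ T MT).
case: (PQ _ (MD MS MT)) => [PST|QST]; first exact: nP (hP _ _ MS MT PST PT).
exact: nQ (hQ _ _ MS MT QST QS).
Qed.

(** The alternative of [mul_or_antimul] may depend on S and T; [cover_alternative]
    makes it uniform first in T, then in S. The argument is due to Herstein and
    Smiley. *)
Theorem jordan_alternative :
  (forall S T, M S -> M T -> psi (S * T) = psi S * psi T) \/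
  (forall S T, M S -> M T -> psi (S * T) = psi T * psi S).
Proof.
pose P S := forall T, M T -> psi (S * T) = psi S * psi T.
pose Q S := forall T, M T -> psi (S * T) = psi T * psi S.
have alt S : M S -> P S \/ Q S.
  move=> MS; apply: cover_alternative => [T MT|T U MT MU|T U MT MU].
  - exact: mul_or_antimul.
  - have [m1 m2] := (MM MS MT, MM MS MU).
    by rewrite mulrDr !psiD // mulrDr => + E; rewrite E => /addIr.
  - have [m1 m2] := (MM MS MT, MM MS MU).
    by rewrite mulrDr !psiD // mulrDl => + E; rewrite E => /addrI.
suff [h|h] : (forall S, M S -> P S) \/ (forall S, M S -> Q S).
- by left=> S T MS; exact: h.
- by right=> S T MS; exact: h.
apply: cover_alternative => // S T MS MT.
  move=> PST PT U MU; have [m1 m2] := (MM MS MU, MM MT MU).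
  by have := PST U MU; rewrite mulrDl !psiD // mulrDl (PT U MU) => /addIr.
move=> QST QS U MU; have [m1 m2] := (MM MS MU, MM MT MU).
by have := QST U MU; rewrite mulrDl !psiD // mulrDr (QS U MU) => /addrI.
Qed.
End Herstein.

(** * Linear extension of a sequential isomorphism *)

Section Extension.
Context (R : realType) (H K : hilbertType R) (M : set (bop H)) (N : set (bop K)).
Variables (f : bop H -> bop K) (g : bop K -> bop H).
Hypothesis si : seqiso M N f g.
Implicit Types (S T a b : bop H) (t s e r : R).
Let vM : vna M := factor_vna (si_factM si).
Let vN : vna N := factor_vna (si_factN si).

Definition bounds (L : hilbertType R) (a : bop L) r :=
  [/\ 0 < r, pos (scal L r + a) & pos (scal L r - a)].
(** An effect whenever r bounds a. *)
Definition unitize (L : hilbertType R) r (a : bop L) := ((2 * r)^-1)%:C *: (scal L r + a).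

(** The only possible value at a of a real linear unital extension of f, given that
    r bounds a. *)
Definition ext_with r a : bop K := (2 * r)%:C *: f (unitize r a) - scal K r.
(** Every selfadjoint element has a bound, so the default 1 is never used on one. *)
Definition ext_sa a : bop K := ext_with (xget 1 [set r | bounds a r]) a.

Lemma sa_bounds (L : hilbertType R) (a : bop L) : sa a -> exists r, bounds a r.
Proof. by move=> /sa_bounded[r r0 [p q]]; exists r. Qed.

Lemma bounds_le (L : hilbertType R) (a : bop L) r s : bounds a r -> r <= s -> bounds a s.
Proof.
move=> [r0 p q] rs; split; first exact: lt_le_trans rs.
  have -> : scal L s + a = scal L (s - r) + (scal L r + a).
    by rewrite addrA -scalD subrK.
  by apply: posD => //; apply: pos_scal; rewrite subr_ge0.
have -> : scal L s - a = scal L (s - r) + (scal L r - a).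
  by rewrite addrA -scalD subrK.
by apply: posD => //; apply: pos_scal; rewrite subr_ge0.
Qed.

Lemma eff_unitize r a : M a -> bounds a r -> eff M (unitize r a).
Proof. by move=> Ma [r0 p q]; exact: eff_affine. Qed.

Lemma unitize_mix r s a : 0 < r -> 0 < s ->
  unitize s a = (r / s)%:C *: unitize r a + scal H ((1 - r / s) / 2).
Proof.
move=> r0 s0; have [rn sn] : r != 0 /\ s != 0 by rewrite !gt_eqF.
rewrite /unitize /scal !scalerDr !scalerA -!rmorphM addrAC -scalerDl -rmorphD.
by rewrite /=; congr (_%:C *: _ + _%:C *: _); field; rewrite ?rn ?sn.
Qed.

Lemma ext_with_indep r s a : M a -> bounds a r -> bounds a s -> ext_with r a = ext_with s a.
Proof.
move=> Ma; wlog rs : r s / r <= s => [hw br bs|br bs].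
  by case: (leP r s) => [rs|/ltW sr]; [exact: hw | symmetry; exact: hw].
have [r0 _ _] := br; have [s0 _ _] := bs; have [rn sn] : r != 0 /\ s != 0 by rewrite !gt_eqF.
have er := eff_unitize Ma br; have es := eff_unitize Ma bs.
have q01 : 0 <= r / s <= 1 by rewrite divr_ge0 ?(ltW r0) ?(ltW s0) //= ler_pdivrMr // mul1r.
have h01 : 0 <= (1 - r / s) / 2 <= 1 by move: q01; move: (r / s) => q /andP[q0 q1]; apply/andP; split; lra.
have mix := unitize_mix a r0 s0.
rewrite /ext_with [in RHS]mix (si_add si) -?mix //; try exact: eff_scale; try exact: eff_scal.
rewrite (si_scale si) // (si_scal si) // scalerDr scalerA -rmorphM /scal scalerA -rmorphM.
rewrite -addrA -scalerBl -rmorphB -scaleNr -rmorphN.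
by rewrite /=; congr (_%:C *: _ + _%:C *: _); field.
Qed.

Lemma ext_saE r a : M a -> bounds a r -> ext_sa a = ext_with r a.
Proof.
move=> Ma br; apply: ext_with_indep => //.
by have := @xgetPex _ 1 [set r | bounds a r] (ex_intro _ r br).
Qed.

Lemma ext_unitize r a : M a -> bounds a r -> f (unitize r a) = unitize r (ext_sa a).
Proof.
move=> Ma br; rewrite (ext_saE Ma br) /ext_with /unitize addrCA subrr addr0.
have [r0 _ _] := br; rewrite scalerA -rmorphM mulVf ?scale1r //.
by rewrite mulf_neq0 ?gt_eqF.
Qed.

Lemma ext_sa_N a : M a -> sa a -> N (ext_sa a) /\ sa (ext_sa a).
Proof.
move=> Ma /sa_bounds[r br]; rewrite (ext_saE Ma br).
have [Nf pf _] := si_eff si (eff_unitize Ma br); split.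
  by apply: vnaB => //; [exact: vnaZ | exact: vna_scal].
by apply: saB; [apply: saZ; exact: pos_sa | exact: sa_scal].
Qed.

Lemma ext_sa_eff a : eff M a -> ext_sa a = f a.
Proof.
move=> ea; have [Ma pa qa] := ea.
have b1 : bounds a 1.
  by split; rewrite ?scal1 //; apply: posD => //; exact: pos1.
have h01 : 0 <= (2^-1 : R) <= 1 by apply/andP; split; lra.
have uE : unitize 1 a = scal H 2^-1 + (2^-1)%:C *: a.
  by rewrite /unitize mulr1 scalerDr scal1.
have eu := eff_unitize Ma b1.
rewrite (ext_saE Ma b1) /ext_with uE (si_add si) -?uE //; try exact: eff_scale; try exact: eff_scal.
rewrite (si_scal si) // (si_scale si) // scalerDr /scal !scalerA -!rmorphM mulr1 mulfV //.
by rewrite !scale1r addrC addKr.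
Qed.

Lemma ext_saD a b : M a -> sa a -> M b -> sa b -> ext_sa (a + b) = ext_sa a + ext_sa b.
Proof.
move=> Ma /sa_bounds[r br] Mb /sa_bounds[s bs].
have [[r0 _ _] [s0 _ _]] := (br, bs).
have ba : bounds a (r + s) by apply: bounds_le br _; lra.
have bb : bounds b (r + s) by apply: bounds_le bs _; lra.
move: (r + s) ba bb => t ba bb {r s br bs r0 s0}.
have [t0 pa qa] := ba; have [_ pb qb] := bb; have tn : t != 0 by rewrite gt_eqF.
have bab : bounds (a + b) (2 * t).
  have e2 : 2 * t = t + t by lra.
  split; first by rewrite mulr_gt0.
    by rewrite e2 scalD addrACA; exact: posD.
  by rewrite e2 scalD opprD addrACA; exact: posD.
have Mab := vnaD vM Ma Mb.
have h01 : 0 <= (2^-1 : R) <= 1 by apply/andP; split; lra.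
have uE : unitize (2 * t) (a + b) = (2^-1)%:C *: unitize t a + (2^-1)%:C *: unitize t b.
  rewrite /unitize !scalerA -!rmorphM -scalerDr addrACA -scalD.
  have -> : t + t = 2 * t by lra.
  by rewrite /=; congr (_%:C *: _); field.
have [[eua eub] euab] := (eff_unitize Ma ba, eff_unitize Mb bb, eff_unitize Mab bab).
rewrite (ext_saE Mab bab) (ext_saE Ma ba) (ext_saE Mb bb) /ext_with uE (si_add si) -?uE //; try exact: eff_scale.
rewrite (si_scale si h01 eua) (si_scale si h01 eub) scalerDr !scalerA -!rmorphM addrACA -opprD -scalD.
have -> : t + t = 2 * t by lra.
by have -> : 2 * (2 * t) / 2 = 2 * t by field.
Qed.

Lemma ext_sa0 : ext_sa 0 = 0.
Proof.
have := ext_saD (vna0 vM) (@sa0 _ H) (vna0 vM) (@sa0 _ H).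
by rewrite addr0 => /eqP; rewrite -subr_eq0 opprD addrA subrr sub0r oppr_eq0 => /eqP.
Qed.
Lemma ext_saN a : M a -> sa a -> ext_sa (- a) = - ext_sa a.
Proof.
move=> Ma sa_a; have := ext_saD Ma sa_a (vnaN vM Ma) (saN sa_a).
by rewrite subrr ext_sa0 => /esym/eqP; rewrite addrC addr_eq0 => /eqP.
Qed.

Lemma ext_saZ t a : M a -> sa a -> ext_sa (t%:C *: a) = t%:C *: ext_sa a.
Proof.
have unit s b : 0 <= s <= 1 -> M b -> sa b -> ext_sa (s%:C *: b) = s%:C *: ext_sa b.
  move=> s01 Mb sb; have [r br] := sa_bounds sb; have [r0 p q] := br.
  have /andP[s0 s1] := s01; have rn : r != 0 by rewrite gt_eqF.
  have bs : bounds (s%:C *: b) r.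
    have e : scal H r = scal H ((1 - s) * r) + s%:C *: scal H r.
      by rewrite -scalMl -scalM -scalD; congr scal; ring.
    have pr : pos (scal H ((1 - s) * r)) by apply: pos_scal; apply: mulr_ge0; lra.
    split=> //; rewrite e -addrA -?scalerDr -?scalerBr; apply: posD => //; exact: posZ.
  have Msb := vnaZ vM s%:C Mb.
  have h01 : 0 <= (1 - s) / 2 <= 1 by apply/andP; split; lra.
  have uE : unitize r (s%:C *: b) = s%:C *: unitize r b + scal H ((1 - s) / 2).
    rewrite /unitize /scal !scalerDr !scalerA -!rmorphM addrAC -scalerDl -rmorphD.
    by rewrite /=; congr (_%:C *: _ + _%:C *: _); field.
  have [e1 e2] := (eff_unitize Mb br, eff_unitize Msb bs).
  rewrite (ext_saE Mb br) (ext_saE Msb bs) /ext_with uE (si_add si) -?uE //; try exact: eff_scale; try exact: eff_scal.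
  rewrite (si_scale si s01 e1) (si_scal si) // scalerDr scalerBr /scal !scalerA -!rmorphM.
  rewrite -addrA -scalerBl -rmorphB -scaleNr -rmorphN.
  by rewrite /=; congr (_%:C *: _ + _%:C *: _); field.
have nonneg s b : 0 <= s -> M b -> sa b -> ext_sa (s%:C *: b) = s%:C *: ext_sa b.
  move=> s0 Mb sb; have [s1|/ltW s1] := leP s 1; first by apply: unit => //; rewrite s0.
  have sn : s != 0 by rewrite gt_eqF //; lra.
  have sC : s%:C != 0 :> R[i] by rewrite fmorph_eq0.
  have i01 : 0 <= s^-1 <= 1 by rewrite invr_ge0 s0 /= invf_le1 //; lra.
  have := unit _ _ i01 (vnaZ vM s%:C Mb) (saZ s sb).
  by rewrite scalerA -rmorphM mulVf // scale1r => ->; rewrite scalerA -rmorphM mulfV // scale1r.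
move=> Ma sa_a; have [t0|t0] := leP 0 t; first exact: nonneg.
rewrite -[t]opprK rmorphN scaleNr ext_saN ?nonneg //; first by rewrite scaleNr.
- by rewrite oppr_ge0 ltW.
- exact: vnaZ.
- exact: saZ.
Qed.

Lemma ext_sa_scal t : ext_sa (scal H t) = scal K t.
Proof.
rewrite /scal ext_saZ; [|exact: (vna1 vM)|exact: sa1].
by rewrite ext_sa_eff ?(si1 si) //; exact: eff1.
Qed.

Lemma ext_saB a b : M a -> sa a -> M b -> sa b -> ext_sa (a - b) = ext_sa a - ext_sa b.
Proof.
by move=> Ma sa_a Mb sb; rewrite ext_saD ?ext_saN //; [exact: vnaN | exact: saN].
Qed.

Lemma unitizeK (L : hilbertType R) r (a : bop L) : r != 0 ->
  a = (2 * r)%:C *: unitize r a - scal L r.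
Proof.
move=> rn; rewrite /unitize scalerA -rmorphM mulfV ?scale1r ?mulf_neq0 //.
by rewrite addrC addKr.
Qed.

Lemma ext_sa_sq a : M a -> sa a -> ext_sa (a * a) = ext_sa a * ext_sa a.
Proof.
move=> Ma sa_a; have [r br] := sa_bounds sa_a; have [r0 _ _] := br.
have rn : r != 0 by rewrite gt_eqF.
have eu := eff_unitize Ma br; have aE := unitizeK a rn.
have fE : ext_sa a = (2 * r)%:C *: f (unitize r a) - scal K r by rewrite (ext_saE Ma br).
set u := unitize r a in eu aE fE; clearbody u; have [Mu pu _] := eu; have su := pos_sa pu.
have euu : eff M (u * u) by exact: eff_mul.
have [Muu puu _] := euu; have suu := pos_sa puu.
have gen (L : hilbertType R) (w : bop L) (k : R) :
    (k%:C *: w - scal L r) * (k%:C *: w - scal L r) =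
    (k * k)%:C *: (w * w) - (2 * k * r)%:C *: w + scal L (r * r).
  rewrite !mulrBl !mulrBr !scalMl !scalMr -!bscaleAl -!bscaleAr /scal !scalerA -!rmorphM /=.
  rewrite (_ : 2 * k * r = k * r + r * k) ?rmorphD ?scalerDl; last by ring.
  by op_ring.
rewrite fE aE !gen ext_saD; [|by apply: (vnaB vM); apply: (vnaZ vM)|by apply: saB; apply: saZ|exact: (vna_scal vM)|exact: sa_scal].
rewrite ext_saB; [|exact: (vnaZ vM)|exact: saZ|exact: (vnaZ vM)|exact: saZ].
rewrite ext_sa_scal !ext_saZ // !ext_sa_eff //.
by have [_ ->] := si_comm si eu eu erefl.
Qed.

Lemma ext_sa_inj a : M a -> sa a -> ext_sa a = 0 -> a = 0.
Proof.
move=> Ma sa_a e; have [r br] := sa_bounds sa_a; have [r0 _ _] := br.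
have rn : r != 0 by rewrite gt_eqF.
have b0 : bounds (0 : bop H) r by split; rewrite ?addr0 ?subr0 //; apply: pos_scal; exact: ltW.
have E : f (unitize r a) = f (unitize r 0).
  by rewrite !ext_unitize ?e ?ext_sa0 //; exact: vna0.
have := si_inj si (eff_unitize Ma br) (eff_unitize (vna0 vM) b0) E.
by move=> uE; rewrite (unitizeK a rn) uE -unitizeK.
Qed.

Lemma ext_sa_surj (c : bop K) : N c -> sa c -> exists2 a, M a /\ sa a & ext_sa a = c.
Proof.
move=> Nc sc; have [r [r0 p q]] := sa_bounds sc; have rn : r != 0 by rewrite gt_eqF.
have eu : eff N (unitize r c) by exact: eff_affine.
have eg := si_eff' si eu; have [Mg pg qg] := eg.
set w := g (unitize r c) in eg Mg pg qg.
pose a := (2 * r)%:C *: w - scal H r.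
have Ma : M a by apply: (vnaB vM); [exact: (vnaZ vM) | exact: (vna_scal vM)].
have sa_a : sa a by apply: saB; [apply: saZ; exact: pos_sa | exact: sa_scal].
have r2 : 0 <= 2 * r by lra.
have ba : bounds a r.
  split=> //; rewrite /a; first by rewrite addrC subrK; exact: posZ.
  have -> : scal H r - ((2 * r)%:C *: w - scal H r) = (2 * r)%:C *: (1 - w).
    rewrite scalerBr -/(scal H (2 * r)) (_ : 2 * r = r + r) ?scalD; last by lra.
    by rewrite opprB addrC addrAC.
  exact: posZ.
exists a => //; rewrite (ext_saE Ma ba) /ext_with.
have -> : unitize r a = w.
  rewrite /unitize /a [X in _ *: X]addrC subrK scalerA -rmorphM mulVf ?scale1r //.
  by rewrite mulf_neq0.
by rewrite (si_K' si) // -unitizeK.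
Qed.

Definition re_op T : bop H := (2^-1)%:C *: (T + adj T).
Definition im_op T : bop H := ((2^-1)%:C * - 'i) *: (T - adj T).

Lemma conj_i : conjc 'i = - 'i :> R[i].
Proof. by apply/eqP; rewrite eq_complex /= oppr0 !eqxx. Qed.
Lemma ii : 'i * 'i = -1 :> R[i]. Proof. by rewrite -expr2 sqr_i. Qed.
Lemma half2 : (2^-1)%:C + (2^-1)%:C = 1 :> R[i].
Proof. by rewrite -rmorphD /=; congr (_%:C); field. Qed.

Lemma adj_parts (L : hilbertType R) (a b : bop L) : sa a -> sa b -> adj (a + 'i *: b) = a - 'i *: b.
Proof. by move=> sa_a sb; rewrite adjD adjZ conj_i sa_a sb scaleNr. Qed.

Lemma re_parts a b : sa a -> sa b -> re_op (a + 'i *: b) = a.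
Proof.
move=> sa_a sb; rewrite /re_op adj_parts // addrACA subrr addr0 scalerDr.
by rewrite -scalerDl half2 scale1r.
Qed.
Lemma im_parts a b : sa a -> sa b -> im_op (a + 'i *: b) = b.
Proof.
move=> sa_a sb; rewrite /im_op adj_parts // opprB addrC addrA subrK.
have e : (2^-1)%:C * - 'i * 'i = (2^-1)%:C :> R[i] by rewrite -mulrA mulNr ii opprK mulr1.
by rewrite -scalerDr scalerA e scalerDr -scalerDl half2 scale1r.
Qed.
Lemma parts T : T = re_op T + 'i *: im_op T /\ (sa (re_op T) /\ sa (im_op T)).
Proof.
have [a [b [sa_a sb TE _]]] := sa_parts T.
by rewrite {1}TE TE re_parts // im_parts.
Qed.
Lemma parts_M T : M T -> M (re_op T) /\ M (im_op T).
Proof.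
move=> MT; have Ma := vna_adj vM MT.
by split; apply: vnaZ => //; [exact: vnaD | exact: vnaB].
Qed.

Definition ext T : bop K := ext_sa (re_op T) + 'i *: ext_sa (im_op T).

Lemma ext_parts a b : sa a -> sa b -> ext (a + 'i *: b) = ext_sa a + 'i *: ext_sa b.
Proof. by move=> sa_a sb; rewrite /ext re_parts // im_parts. Qed.

Lemma ext_N T : M T -> N (ext T).
Proof.
move=> MT; have [_ [sr sm]] := parts T; have [Mr Mi] := parts_M MT.
apply: (vnaD vN); last apply: (vnaZ vN).
  by have [] := ext_sa_N Mr sr.
by have [] := ext_sa_N Mi sm.
Qed.

Lemma ext_eff T : eff M T -> ext T = f T.
Proof.
move=> eT; have [MT pT _] := eT; have sT := pos_sa pT.
have := ext_parts sT (@sa0 _ H); rewrite scaler0 addr0 => ->.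
by rewrite ext_sa0 scaler0 addr0 ext_sa_eff.
Qed.

Lemma ext_adj T : M T -> ext (adj T) = adj (ext T).
Proof.
move=> MT; have [TE [sr sm]] := parts T; have [Mr Mi] := parts_M MT.
have [[Nr sNr] [Ni sNi]] := (ext_sa_N Mr sr, ext_sa_N Mi sm).
rewrite {2}/ext adj_parts // {1}TE adj_parts // -scalerN ext_parts ?ext_saN //; last exact: saN.
by rewrite scalerN.
Qed.

Lemma ext_lin (c : R[i]) S T : M S -> M T -> ext (c *: S + T) = c *: ext S + ext T.
Proof.
move=> MS MT; have [SE [sr sm]] := parts S; have [Mr Mi] := parts_M MS.
have [TE [tr tm]] := parts T; have [Nr Ni] := parts_M MT.
case: c => x y.
have cE : x +i* y = x%:C + 'i * y%:C by rewrite [LHS]complexE.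
have comb (L : hilbertType R) (a b a' b' : bop L) : (x +i* y) *: (a + 'i *: b) + (a' + 'i *: b') =
    (x%:C *: a - y%:C *: b + a') + 'i *: (y%:C *: a + x%:C *: b + b').
  rewrite cE !scalerDl !scalerDr !scalerA.
  have -> : 'i * y%:C * 'i = - y%:C :> R[i] by rewrite mulrAC ii mulN1r.
  by rewrite scaleNr (mulrC x%:C); op_ring.
rewrite {1}SE {1}TE comb ext_parts; last 2 first.
- by apply: saD => //; apply: saB; apply: saZ.
- by apply: saD => //; apply: saD; apply: saZ.
rewrite /ext comb.
have Z t a : M a -> M (t%:C *: a) by exact: vnaZ.
rewrite (ext_saD (vnaB vM (Z x _ Mr) (Z y _ Mi)) (saB (saZ x sr) (saZ y sm)) Nr tr).
rewrite (ext_saD (vnaD vM (Z y _ Mr) (Z x _ Mi)) (saD (saZ y sr) (saZ x sm)) Ni tm).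
rewrite (ext_saB (Z x _ Mr) (saZ x sr) (Z y _ Mi) (saZ y sm)).
rewrite (ext_saD (Z y _ Mr) (saZ y sr) (Z x _ Mi) (saZ x sm)).
by rewrite (ext_saZ x Mr sr) (ext_saZ y Mi sm) (ext_saZ y Mr sr) (ext_saZ x Mi sm).
Qed.

Lemma extD S T : M S -> M T -> ext (S + T) = ext S + ext T.
Proof. by move=> MS MT; have := ext_lin 1 MS MT; rewrite !scale1r. Qed.

Lemma ext_sa_jordan a b : M a -> sa a -> M b -> sa b ->
  ext_sa (a * b + b * a) = ext_sa a * ext_sa b + ext_sa b * ext_sa a.
Proof.
move=> Ma sa_a Mb sb.
have e : a * b + b * a = (a + b) * (a + b) - a * a - b * b by rewrite !mulrDl !mulrDr; op_ring.
have [m1 m2 m3] : [/\ M ((a + b) * (a + b)), M (a * a) & M (b * b)].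
  by split; apply: (vnaM vM) => //; exact: (vnaD vM).
have sq (c : bop H) : sa c -> sa (c * c) by move=> sc; exact: saM.
have s1 : sa ((a + b) * (a + b)) by apply: sq; exact: saD.
rewrite e (ext_saB (vnaB vM m1 m2) (saB s1 (sq _ sa_a)) m3 (sq _ sb)).
rewrite (ext_saB m1 s1 m2 (sq _ sa_a)) (ext_sa_sq (vnaD vM Ma Mb) (saD sa_a sb)).
rewrite (ext_saD Ma sa_a Mb sb) !ext_sa_sq // !mulrDl !mulrDr; op_ring.
Qed.

Lemma ext_sq T : M T -> ext (T * T) = ext T * ext T.
Proof.
move=> MT; have [TE [sr sm]] := parts T; have [Mr Mi] := parts_M MT.
set a := re_op T in TE sr Mr; set b := im_op T in TE sm Mi.
have sqE (L : hilbertType R) (c d : bop L) : (c + 'i *: d) * (c + 'i *: d) =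
    (c * c - d * d) + 'i *: (c * d + d * c).
  rewrite !mulrDl !mulrDr -!bscaleAl -!bscaleAr !scalerA ii scaleN1r scalerDr.
  by op_ring.
rewrite {1 2}TE sqE ext_parts; last 2 first.
- by apply: saB; apply: saM.
- by rewrite /sa adjD !adjM sr sm addrC.
rewrite ext_sa_jordan // ext_saB ?ext_sa_sq //; first by rewrite [ext T]/ext sqE.
- exact: (vnaM vM).
- exact: saM.
- exact: (vnaM vM).
- exact: saM.
Qed.

Lemma ext_inj S T : M S -> M T -> ext S = ext T -> S = T.
Proof.
move=> MS MT e; have MD : M (S - T) by exact: (vnaB vM).
apply/eqP; rewrite -subr_eq0; apply/eqP.
have e0 : ext (S - T) = 0.
  have := extD MD MT; rewrite subrK e => /eqP.
  by rewrite addrC -subr_eq0 opprD addrA subrr sub0r oppr_eq0 => /eqP.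
have [DE [sr sm]] := parts (S - T); have [Mr Mi] := parts_M MD.
have [[_ sNr] [_ sNi]] := (ext_sa_N Mr sr, ext_sa_N Mi sm).
move: e0; rewrite /ext; set x := ext_sa _; set y := ext_sa _ => e0.
have e1 : x - 'i *: y = 0 by rewrite -adj_parts // e0 adj0.
have x0 : x = 0.
  have : (x + 'i *: y) + (x - 'i *: y) = 0 by rewrite e0 e1 addr0.
  by rewrite addrACA subrr addr0 => xx; apply: double_inj; rewrite xx addr0.
have y0 : y = 0.
  have i0 : 'i != 0 :> R[i] by rewrite eq_complex /= oner_eq0 andbF.
  by apply: (scalerI i0); move: e0; rewrite x0 add0r scaler0.
by rewrite DE (ext_sa_inj Mr sr x0) (ext_sa_inj Mi sm y0) scaler0 addr0.
Qed.

Lemma ext_surj (c : bop K) : N c -> exists2 T, M T & ext T = c.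
Proof.
move=> Nc; have [x [y [sx sy cE /(_ N vN)]]] := sa_parts c.
case=> // Nx Ny.
have [[a [Ma sa_a] aE] [b [Mb sb] bE]] := (ext_sa_surj Nx sx, ext_sa_surj Ny sy).
exists (a + 'i *: b); first by apply: (vnaD vM) => //; exact: (vnaZ vM).
by rewrite ext_parts // aE bE cE.
Qed.

Theorem ext_mul_or_antimul :
  (forall S T, M S -> M T -> ext (S * T) = ext S * ext T) \/
  (forall S T, M S -> M T -> ext (S * T) = ext T * ext S).
Proof.
apply: (@jordan_alternative _ _ _ M N ext).
- exact: vnaD.
- exact: vnaM.
- exact: vnaD.
- exact: vnaN.
- exact: vnaM.
- by move=> a b; exact: (factor_prime (si_factN si)).
- exact: ext_N.
- exact: ext_surj.
- exact: extD.
- exact: ext_sq.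
Qed.
End Extension.

(** * Back to functions on the Hilbert spaces *)

Section Assembly.
Context (R : realType).

Definition to_bop (H : hilbertType R) (t : H -> H) : bop H :=
  if pselect (bounded_ops H t) is left bt then Bop bt else 0.

Lemma to_bopK (H : hilbertType R) (T : bop H) : to_bop T = T.
Proof.
rewrite /to_bop; case: pselect => [bt|/(_ (bfunP T))] //.
exact: bop_ext.
Qed.
Lemma bfun_to_bop (H : hilbertType R) (t : H -> H) : bounded_ops H t -> to_bop t = t :> (H -> H).
Proof. by move=> bt; rewrite /to_bop; case: pselect. Qed.

Lemma effectsE (H : hilbertType R) (A : set (H -> H)) (T : bop H) :
  effects A T <-> eff [set S : bop H | A S] T.
Proof.
have e0 : bfun T - 0 = T by rewrite subr0.
split=> -[AT p q]; split=> //.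
  by move: p; rewrite /le_op e0.
by rewrite /le_op e0.
Qed.

Lemma seq_prodE (H : hilbertType R) (S T : bop H) : pos S -> seq_prod S T = sprod S T.
Proof. by move=> pS; rewrite /seq_prod sqrt_opE. Qed.

Variables (H K : hilbertType R) (A : set (H -> H)) (B : set (K -> K)).
Variable phi : (H -> H) -> (K -> K).
Hypotheses (factorA : vn_factor A) (factorB : vn_factor B).
Hypotheses (A_nontrivial : A <> scalar_ops H) (B_nontrivial : B <> scalar_ops K).
Hypothesis phi_iso : sequential_isomorphism A B phi.

Let M := [set S : bop H | A S].
Let N := [set S : bop K | B S].

Definition phi_bop (T : bop H) : bop K := to_bop (phi T).
Definition phi_inv (S : bop K) : bop H :=
  to_bop (xget 0 [set t | effects A t /\ phi t = S]).

Lemma nonscalar_exists (L : hilbertType R) (C : set (L -> L)) : vn_factor C -> C <> scalar_ops L ->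
  exists2 T, [set S : bop L | C S] T & ~ scalar_op T.
Proof.
move=> fC nC; have fM := factor_of fC; have vM := factor_vna fM; apply: contrapT => nex.
apply: nC; apply/seteqP; split=> [t Ct|_ [c _ <-]].
  have bt := vN_bounded fC.1 Ct.
  have [c tc] : scalar_op (Bop bt) by apply: contrapT => ns; apply: nex; exists (Bop bt).
  by exists c => //; rewrite -[t]/(bfun (Bop bt)) tc.
exact: (vnaZ vM c (vna1 vM)).
Qed.

Lemma phi_seqiso : seqiso M N phi_bop phi_inv.
Proof.
have [[fEff finj fsurj] fmul] := phi_iso.
have bB t : effects B t -> bounded_ops K t by move=> [/(vN_bounded factorB.1)].
have bA t : effects A t -> bounded_ops H t by move=> [/(vN_bounded factorA.1)].
have phiE T : eff M T -> phi_bop T = phi T :> (K -> K).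
  by move=> /effectsE eT; rewrite bfun_to_bop //; apply: bB; exact: fEff.
have effphi T : eff M T -> eff N (phi_bop T).
  by move=> eT; apply/effectsE; rewrite phiE //; apply: fEff; exact/effectsE.
have inv S : eff N S -> eff M (phi_inv S) /\ phi (phi_inv S) = S.
  move=> /effectsE eS; have [t et tS] := fsurj _ eS.
  have := @xgetPex _ 0 [set t | effects A t /\ phi t = S] (ex_intro _ t (conj et tS)).
  rewrite /phi_inv; move: (xget _ _) => u /= [eu uS].
  have uE := bfun_to_bop (bA _ eu).
  by split; [apply/effectsE|]; rewrite uE.
split.
- exact: factor_of.
- exact: factor_of.
- exact: nonscalar_exists.
- exact: nonscalar_exists.
- exact: effphi.
- by move=> S /inv[].
- move=> T eT; have [eg gE] := inv _ (effphi _ eT).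
  apply: bop_ext => x; congr (_ x); apply: finj; rewrite ?inE; try exact/effectsE.
  by rewrite gE phiE.
- move=> S eS; have [eg gE] := inv _ eS.
  by apply: bop_ext => x; rewrite phiE // gE.
- move=> S T eS eT; have vM := factor_vna (factor_of factorA).
  have [_ pS _] := eS; have [_ pfS _] := effphi _ eS.
  have := fmul _ _ ((effectsE A S).2 eS) ((effectsE A T).2 eT).
  rewrite seq_prodE // -(phiE _ eS) -(phiE _ eT) seq_prodE // => E.
  apply: bop_ext => x; rewrite phiE; first by rewrite E.
  exact: eff_sprod.
Qed.

Definition psi_fun (t : H -> H) : K -> K := ext phi_bop (to_bop t).

Theorem sequential_isomorphism_extends :
  (star_isomorphism A B psi_fun \/ star_antiisomorphism A B psi_fun) /\
  (forall T : H -> H, effects A T -> psi_fun T = phi T).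
Proof.
have si := phi_seqiso; have vM := factor_vna (si_factM si).
have lift t : A t -> exists2 T : bop H, M T & t = T.
  by move=> At; exists (Bop (vN_bounded factorA.1 At)).
have psiE (T : bop H) : psi_fun T = ext phi_bop T by rewrite /psi_fun to_bopK.
have lin : star_linear_bijection A B psi_fun.
  split.
  - split.
    + by move=> _ /lift[T MT ->]; rewrite /= psiE; exact: (ext_N si).
    + move=> s t; rewrite !inE => /lift[S MS ->] /lift[T MT ->]; rewrite !psiE => E.
      by congr bfun; apply: (ext_inj si) => //; apply: bop_ext => x; rewrite E.
    + move=> u Bu; have Nu : N (Bop (vN_bounded factorB.1 Bu)) by [].
      have [T MT TE] := ext_surj si Nu.
      by exists T => //; rewrite psiE TE.
  - move=> c s t /lift[S MS ->] /lift[T MT ->]; rewrite !psiE.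
    by rewrite -[c *: bfun S + bfun T]/(bfun (c *: S + T)) psiE (ext_lin si).
  - move=> t /lift[T MT ->]; rewrite !psiE !adjoint_adj psiE (ext_adj si) //.
split; last first.
  move=> t et; have [At _ _] := et; have [T MT tE] := lift t At.
  have eT : eff M T by apply/effectsE; rewrite -tE.
  rewrite tE psiE (ext_eff si eT) bfun_to_bop //.
  have [[fEff _ _] _] := phi_iso.
  by have [/(vN_bounded factorB.1)] := fEff _ ((effectsE A T).2 eT).
have [mul|mul] := ext_mul_or_antimul si; [left|right]; split=> // s t /lift[S MS ->] /lift[T MT ->].
  by rewrite -[bfun S \o bfun T]/(bfun (S * T)) !psiE mul.
by rewrite -[bfun S \o bfun T]/(bfun (S * T)) !psiE mul.
Qed.
End Assembly.

Theorem corollary2 (R : realType) (H K : hilbertType R)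
    (A : set (H -> H)) (B : set (K -> K)) (phi : (H -> H) -> (K -> K))
    (factorA : vn_factor A) (factorB : vn_factor B)
    (A_nontrivial : A <> scalar_ops H) (B_nontrivial : B <> scalar_ops K)
    (phi_iso : sequential_isomorphism A B phi) :
  exists psi : (H -> H) -> (K -> K),
    (star_isomorphism A B psi \/ star_antiisomorphism A B psi) /\
    (forall T : H -> H, effects A T -> psi T = phi T).
Proof.
by exists (psi_fun phi); exact: sequential_isomorphism_extends.
Qed.
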